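(* Let $p>8$ and $\kappa:=(p-8)/(p+16)>0$. There is a constant $A=A(p)$, and for every $E>0$ there are constants $\delta_1=\delta_1(E,p)>0$ and $C(p,E)$, such that the following holds for every admissible surface $\Sigma\in\mathscr{A}$ with $\mathcal{M}_p(\Sigma)<E$. For each $x\in\Sigma$ there exists a unique plane $T_x\Sigma$ (a two-dimensional linear subspace of $\mathbb{R}^3$, called the tangent plane of $\Sigma$ at $x$) such that $$\operatorname{dist}(x',x+T_x\Sigma)\ \le\ C(p,E)\,|x'-x|^{1+\kappa}\qquad\text{for all } x'\in\Sigma\cap B(x,\delta_1).$$ Moreover, whenever $x,y\in\Sigma$ with $0<d=|x-y|\le\delta_1(E,p)$, then $$\angle(T_x\Sigma,T_y\Sigma)\ \le\ A(p)\,E^{1/(p+16)}\,d^{\kappa}.$$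
   Context: $B(x,r)$ denotes the closed ball of radius $r$ centered at $x\in\mathbb{R}^3$; $\angle(P,Q)\in[0,\pi/2]$ is the angle between two planes. For $\varphi\in(0,\pi/2)$ and $w\in\mathbb{S}^2$ put $C^{\pm}(\varphi,w)=\{y\in\mathbb{R}^3:\pm\,y\cdot w\ge|y|\cos\varphi\}$. The class $\mathscr{A}$ of admissible surfaces consists of all compact connected sets $\Sigma\subset\mathbb{R}^3$ with $\Sigma=\partial U$ for some bounded domain $U\subset\mathbb{R}^3$ such that: (i) there is a constant $K=K(\Sigma)$ with $\infty>\mathcal{H}^2(\Sigma\cap B(x,r))\ge K^{-1}r^2$ for all $x\in\Sigma$ and $0<r\le\operatorname{diam}\Sigma$; (ii) there is a dense subset $\Sigma^\ast\subset\Sigma$ such that for each $x\in\Sigma^\ast$ there are $v=v(x)\in\mathbb{S}^2$ and $\delta_0=\delta_0(x)>0$ with $B(x,\delta_0)\cap(x+C^+(\pi/4,v))\subset U\cup\{x\}$ and $B(x,\delta_0)\cap(x+C^-(\pi/4,v))\subset(\mathbb{R}^3\setminus\overline U)\cup\{x\}$. For a tetrahedron $T=(x_0,x_1,x_2,x_3)\in(\mathbb{R}^3)^4$ put $\mathcal{K}(T)=\dfrac{V(T)}{A(T)(\operatorname{diam}T)^2}$ if the four vertices are not co-planar, and $\mathcal{K}(T)=0$ otherwise, where $V(T)$ is the volume of $T$ and $A(T)$ is the sum of the areas of its four triangular faces. The integral Menger curvature is $\mathcal{M}_p(\Sigma)=\int_{\Sigma}\int_\Sigma\int_\Sigma\int_\Sigma\mathcal{K}^p(x_0,x_1,x_2,x_3)\,d\mathcal{H}^2(x_0)\,d\mathcal{H}^2(x_1)\,d\mathcal{H}^2(x_2)\,d\mathcal{H}^2(x_3)$,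 with $\mathcal{H}^2$ the two-dimensional Hausdorff measure. *)

(* Defs.v *)
From HB Require Import structures.
From mathcomp Require Import all_boot all_order all_algebra.
From mathcomp Require Import all_classical all_reals all_analysis.

Set Implicit Arguments.
Unset Strict Implicit.
Unset Printing Implicit Defensive.

Import Order.TTheory GRing.Theory Num.Theory.
Import numFieldNormedType.Exports.

Local Open Scope classical_set_scope.
Local Open Scope ring_scope.

(* R^3 is 'rV[R]_3. The norm that MathComp-Analysis puts on matrices is the sup
   norm, so every metric notion below goes through the Euclidean norm [enorm];
   [open], [closure], [compact], [connected] and [bounded_set] are taken from
   the library, since they do not depend on the choice of the norm. *)
Definition dot (R : realType) (u v : 'rV[R]_3) : R := \sum_i u 0 i * v 0 i.

Definition enorm (R : realType) (u : 'rV[R]_3) : R := Num.sqrt (dot u u).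

Definition eball (R : realType) (x : 'rV[R]_3) (r : R) : set 'rV[R]_3 :=
  [set y | enorm (y - x) <= r].

Definition translate (R : realType) (x : 'rV[R]_3) (S : set 'rV[R]_3) :
  set 'rV[R]_3 := [set x + v | v in S].

(* Maximum with 0 because [ereal_sup set0 = -oo]. *)
Definition ediam (R : realType) (S : set 'rV[R]_3) : \bar R :=
  maxe 0%E (ereal_sup [set (enorm (q.1 - q.2))%:E | q in S `*` S]).

Definition dist_to (R : realType) (z : 'rV[R]_3) (S : set 'rV[R]_3) : R :=
  inf [set enorm (z - y) | y in S].

Definition cone_pos (R : realType) (phi : R) (w : 'rV[R]_3) : set 'rV[R]_3 :=
  [set y | enorm y * cos phi <= dot y w].

Definition cone_neg (R : realType) (phi : R) (w : 'rV[R]_3) : set 'rV[R]_3 :=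
  [set y | enorm y * cos phi <= - dot y w].

Section hausdorff_measure.
Local Open Scope ereal_scope.
Variable R : realType.
Implicit Types (S : set 'rV[R]_3) (delta : R).

Definition hausdorff2_cover delta S : set ((set 'rV[R]_3)^nat) :=
  [set C | (forall i, ediam (C i) <= delta%:E) /\ S `<=` \bigcup_i C i].

(* pi/4 is the area of a disc of diameter 1. *)
Definition hausdorff2_weight S : \bar R := (pi / 4)%:E * ediam S ^+ 2.

Definition hausdorff2_delta delta S : \bar R :=
  ereal_inf [set \sum_(i <oo) hausdorff2_weight (C i) |
             C in hausdorff2_cover delta S].

Definition hausdorff2 S : \bar R :=
  ereal_sup [set hausdorff2_delta delta S | delta in [set d : R | (0 < d)%R]].

Lemma ediam_ge0 S : 0 <= ediam S.
Proof. by rewrite /ediam le_max lexx. Qed.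

Lemma ediam0 : ediam (set0 : set 'rV[R]_3) = 0.
Proof.
by rewrite /ediam set0X image_set0 ereal_sup0; apply/max_idPl; rewrite leNye.
Qed.

Lemma hausdorff2_weight_ge0 S : 0 <= hausdorff2_weight S.
Proof.
rewrite /hausdorff2_weight mule_ge0//; last by rewrite expe_ge0// ediam_ge0.
by rewrite lee_fin divr_ge0// pi_ge0.
Qed.

Lemma hausdorff2_delta_ge0 delta S : 0 <= hausdorff2_delta delta S.
Proof.
apply: le_ereal_inf_tmp => _ [C _ <-].
by apply: nneseries_ge0 => n _ _; exact: hausdorff2_weight_ge0.
Qed.

Lemma hausdorff2_delta0 delta : (0 < delta)%R ->
  hausdorff2_delta delta set0 = 0.
Proof.
move=> delta0; apply/eqP; rewrite eq_le hausdorff2_delta_ge0 andbT.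
apply: ereal_inf_lbound; exists (fun=> set0).
  by split=> // i; rewrite ediam0 lee_fin ltW.
by apply: eseries0 => i _ _; rewrite /hausdorff2_weight ediam0 expe2 mule0 mule0.
Qed.

Lemma le_hausdorff2_delta delta S1 S2 : S1 `<=` S2 ->
  hausdorff2_delta delta S1 <= hausdorff2_delta delta S2.
Proof.
move=> S12; apply: ereal_inf_le_tmp => _ [C [dC S2C] <-].
by exists C => //; split => //; exact: subset_trans S12 S2C.
Qed.

Lemma hausdorff2_delta_sigma_subadditive delta :
  sigma_subadditive (hausdorff2_delta delta).
Proof.
move=> A; have [[i ioo]|] := pselect (exists i, hausdorff2_delta delta (A i) = +oo).
  rewrite (eseries_pinfty _ _ ioo) ?leey// => n _.
  by rewrite -ltNye (lt_le_trans _ (hausdorff2_delta_ge0 _ _)).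
rewrite -forallNE => Aoo.
suff add2e (e : {posnum R}) : hausdorff2_delta delta (\bigcup_n A n) <=
    \sum_(i <oo) hausdorff2_delta delta (A i) + e%:num%:E.
  by apply/lee_addgt0Pr => _/posnumP[].
rewrite (le_trans _ (epsilon_trick _ _ _))//; last first.
  by move=> n; exact: hausdorff2_delta_ge0.
pose P n (B : (set 'rV[R]_3)^nat) := hausdorff2_cover delta (A n) B /\
  \sum_(k <oo) hausdorff2_weight (B k) <=
    hausdorff2_delta delta (A n) + (e%:num / (2 ^ n.+1)%:R)%:E.
have [G PG] : {G : ((set 'rV[R]_3)^nat)^nat & forall n, P n (G n)}.
  apply: (@choice _ _ P) => n.
  have en1 : (0 < e%:num / (2 ^ n.+1)%:R :> R)%R by [].
  have fA : hausdorff2_delta delta (A n) \is a fin_num.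
    by rewrite ge0_fin_numE ?hausdorff2_delta_ge0// ltey; apply/eqP/Aoo.
  have [_ [B AB <-] lB] := lb_ereal_inf_adherent en1 fA.
  by exists B; split => //; exact/ltW.
pose w (ij : nat * nat) := hausdorff2_weight (G ij.1 ij.2).
have w0 ij : 0 <= w ij by exact: hausdorff2_weight_ge0.
apply: (@le_trans _ _ (\esum_(ij in setT) w ij)).
  apply: ereal_inf_lbound => /=.
  have /card_esym/ppcard_eqP[f] := card_nat2.
  exists (fun k => G (f k).1 (f k).2).
    split => [i|t [i _ Ait]]; first exact: (PG _).1.1.
    have [j _ Gt] := (PG i).1.2 _ Ait.
    by exists (f^-1%FUN (i, j)) => //=; rewrite invK ?inE.
  rewrite -(esum_pred_image w _ xpredT) ?[fun=> _]set_true//.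
  by rewrite image_eq.
rewrite (_ : esum _ _ = \sum_(i <oo) \sum_(j <oo) w (i, j)).
  apply: lee_lim.
  - by apply: is_cvg_nneseries => n *; exact: nneseries_ge0.
  - apply: is_cvg_nneseries => n *.
    by rewrite adde_ge0 ?hausdorff2_delta_ge0.
  - by apply: nearW => n; apply: lee_sum => i _; exact: (PG i).2.
rewrite nneseries_esumT; last by move=> n; exact: nneseries_ge0.
under [RHS]eq_esum do rewrite nneseries_esumT//.
by rewrite esum_esum//; congr esum; apply/seteqP; split => -[].
Qed.

Lemma hausdorff2_outer0 : hausdorff2 set0 = 0.
Proof.
apply/eqP; rewrite eq_le; apply/andP; split.
  by apply: ge_ereal_sup => _ [d d0 <-]; rewrite hausdorff2_delta0.
apply: le_trans (ereal_sup_ubound _); last by exists 1%R => //=.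
exact: hausdorff2_delta_ge0.
Qed.

Lemma hausdorff2_outer_ge0 S : 0 <= hausdorff2 S.
Proof.
apply: (@le_trans _ _ (hausdorff2_delta 1 S)); first exact: hausdorff2_delta_ge0.
by apply: ereal_sup_ubound; exists 1%R => //=.
Qed.

Lemma le_hausdorff2 : {homo hausdorff2 : S1 S2 / S1 `<=` S2 >-> S1 <= S2}.
Proof.
move=> S1 S2 S12; apply: ge_ereal_sup => _ [d d0 <-].
apply: (le_trans (le_hausdorff2_delta d S12)).
by apply: ereal_sup_ubound; exists d.
Qed.

Lemma hausdorff2_sigma_subadditive : sigma_subadditive hausdorff2.
Proof.
move=> A; apply: ge_ereal_sup => _ [d d0 <-].
apply: (le_trans (hausdorff2_delta_sigma_subadditive d A)).
apply: lee_nneseries => [i _ _|i _]; first exact: hausdorff2_delta_ge0.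
by apply: ereal_sup_ubound; exists d.
Qed.

HB.instance Definition _ := isOuterMeasure.Build R 'rV[R]_3 hausdorff2
  hausdorff2_outer0 hausdorff2_outer_ge0 le_hausdorff2
  hausdorff2_sigma_subadditive.

Definition hausdorff2_outer : {outer_measure set 'rV[R]_3 -> \bar R} := @hausdorff2.

(* The measure that the outer measure [hausdorff2] induces on its Caratheodory
   sigma-algebra. *)
Definition hausdorff2_measure :
    {measure set (caratheodory_type hausdorff2_outer) -> \bar R} :=
  OuterMeasure.sort hausdorff2_outer.

End hausdorff_measure.

Definition boundary (R : realType) (U : set 'rV[R]_3) : set 'rV[R]_3 :=
  closure U `\` interior U.

Definition two_sided_cone_condition (R : realType) (U : set 'rV[R]_3)
    (x : 'rV[R]_3) : Prop :=
  exists (v : 'rV[R]_3) (delta0 : R), [/\ enorm v = 1, 0 < delta0,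
    eball x delta0 `&` translate x (cone_pos (pi / 4) v) `<=` U `|` [set x] &
    eball x delta0 `&` translate x (cone_neg (pi / 4) v) `<=`
      ~` closure U `|` [set x]].

Definition admissible (R : realType) (Sigma : set 'rV[R]_3) : Prop :=
  [/\ compact Sigma, connected Sigma &
  exists U : set 'rV[R]_3,
  [/\ [/\ open U, connected U, U !=set0 & bounded_set U],
      Sigma = boundary U,
      exists2 K : R, 0 < K & forall x r, Sigma x -> 0 < r ->
        (r%:E <= ediam Sigma)%E ->
        ((K^-1 * r ^+ 2)%:E <= hausdorff2 (Sigma `&` eball x r) < +oo)%E &
      exists2 Sigma' : set 'rV[R]_3,
        Sigma' `<=` Sigma /\ Sigma `<=` closure Sigma' &
        forall x, Sigma' x -> two_sided_cone_condition U x]].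

Section integral_menger_curvature.
Variable R : realType.
Implicit Types T : 4.-tuple 'rV[R]_3.

Definition triangle_area (a b c : 'rV[R]_3) : R :=
  Num.sqrt (dot (b - a) (b - a) * dot (c - a) (c - a) - dot (b - a) (c - a) ^+ 2)
  / 2.

Definition edge_matrix T : 'M[R]_3 :=
  \matrix_(i < 3) (tnth T (lift ord0 i) - tnth T ord0).

Definition coplanar T : bool := (\rank (edge_matrix T) <= 2)%N.

Definition tetra_volume T : R := `|\det (edge_matrix T)| / 6.

(* The i-th face is spanned by the three vertices other than the i-th one. *)
Definition tetra_area T : R :=
  \sum_(i < 4) triangle_area (tnth T (lift i 0)) (tnth T (lift i 1))
                             (tnth T (lift i 2)).

Definition tetra_diam T : R := fine (ediam [set x | x \in T]).

Definition menger_kernel T : R :=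
  if coplanar T then 0
  else tetra_volume T / (tetra_area T * tetra_diam T ^+ 2).

Definition menger_energy (p : R) (Sigma : set 'rV[R]_3) : \bar R :=
  (\int[hausdorff2_measure R]_(x3 in Sigma) \int[hausdorff2_measure R]_(x2 in Sigma)
   \int[hausdorff2_measure R]_(x1 in Sigma) \int[hausdorff2_measure R]_(x0 in Sigma)
     (menger_kernel [tuple (x0 : 'rV[R]_3); (x1 : 'rV[R]_3);
                           (x2 : 'rV[R]_3); (x3 : 'rV[R]_3)] `^ p)%:E)%E.

End integral_menger_curvature.

(* A unit normal of a plane is unique up to sign, which does not affect
   [plane_angle]. *)
Definition unit_normal (R : realType) (P : {vspace 'rV[R]_3}) : 'rV[R]_3 :=
  xget 0 [set n | enorm n = 1 /\ forall v, v \in P -> dot n v = 0].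

Definition plane_angle (R : realType) (P Q : {vspace 'rV[R]_3}) : R :=
  acos `|dot (unit_normal P) (unit_normal Q)|.

Definition is_tangent_plane (R : realType) (kappa delta C : R)
    (Sigma : set 'rV[R]_3) (x : 'rV[R]_3) (P : {vspace 'rV[R]_3}) : Prop :=
  (\dim P = 2%N) /\
  (forall x', (Sigma `&` eball x delta) x' ->
     dist_to x' (translate x [set v | v \in P]) <=
       C * enorm (x' - x) `^ (1 + kappa)).

(* Main.v *)
Require Import Defs.
From mathcomp Require Import all_boot all_order all_algebra.
From mathcomp Require Import all_classical all_reals all_analysis.
From mathcomp Require Import ring lra.

Set Implicit Arguments.
Unset Strict Implicit.
Unset Printing Implicit Defensive.

Import Order.TTheory GRing.Theory Num.Theory.
Import numFieldNormedType.Exports.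

Local Open Scope classical_set_scope.
Local Open Scope ring_scope.

(** Call the surface [eta]-thin at scale [rho] when all tetrahedra with vertices
   in the part of the surface in a ball of radius [rho] have volume at most
   [eta * rho ^+ 3 / 6]. Three ideas carry the proof.

   Thickness costs energy. If the part of the surface in every ball of radius
   comparable to [eta * rho] has measure at least [c] times the squared radius,
   then one tetrahedron that is not [eta]-thin yields a product of four balls on
   which the Menger kernel is at least of the order of [eta / rho], hence an
   energy of at least a constant times [eta `^ (p + 8) * rho `^ (8 - p)]
   ([energy_thin]). As [p > 8], an energy bound makes the surface thin at small
   scales. This uses that closed sets are measurable for the Hausdorff measure,
   proved by means of the criterion for metric outer measures
   ([caratheodory_sublevel]).

   Thinness and topology propagate flatness. The surface is called flat at scale
   [rho] if, outside a thin slab about a plane, the domain fills one half of the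
   ball and the exterior the other half. Flatness forces the surface to meet
   every segment that crosses the slab. It follows that the surface projects
   onto a disc, whence a lower bound for its measure with an absolute constant
   ([flat_ahlfors]); and that it contains two points which span with the centre
   a large triangle. If the surface is thin at twice the scale, it lies there in
   a slab about the plane of this triangle. Each of the caps left over is convex
   and free of boundary points, so it lies on the side on which flatness at the
   smaller scale puts one of its points: the surface is flat at the doubled scale
   ([triad_flat]). The double cones of the definition of admissibility provide a
   first triangle. The growth of the scale is first controlled with the constant
   [K] of the surface, which yields flatness up to some scale common to all cone
   points ([flat_small_scales]). As long as flatness holds, however, the density
   is bounded below by an absolute constant, so flatness goes on up to a scale
   that depends on [p] and [E] only ([flat_uniform_scales]).

   Flatness improves to a power. Below that scale the surface is [eta]-thin with
   [eta] a multiple of [E `^ (1 / (p + 16)) * rho `^ kappa], and so it is flat with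
   such a constant ([flat_power_scales]). The normals of two flatness planes at
   comparable scales and places differ by as much as their flatness constants
   ([flat_compare]), so the normals at a point converge geometrically as
   the scale decreases ([normal_cauchy], [normal_limit]). The orthogonal
   complement of the limit is the tangent plane. It is the only one, as the
   surface meets all segments across the slabs ([limit_normal_unique]), and the
   comparison of the normals at two points at the scale of their distance is the
   estimate of the angle ([limit_normal_holder]). *)

(** * Euclidean geometry of three-space *)

Section euclidean_space.
Variable R : realType.
Implicit Types (u v w x y z n : 'rV[R]_3) (a b c : R).

Notation i0 := (0 : 'I_3).
Notation i1 := (1 : 'I_3).
Notation i2 := (2%:R : 'I_3).

Lemma ord3P (P : 'I_3 -> Prop) : P i0 -> P i1 -> P i2 -> forall i, P i.
Proof.
move=> P0 P1 P2 [[|[|[|//]]] hi].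
- by rewrite (_ : Ordinal hi = i0)//; apply: val_inj.
- by rewrite (_ : Ordinal hi = i1)//; apply: val_inj.
- by rewrite (_ : Ordinal hi = i2)//; apply: val_inj.
Qed.

Lemma sum3 (f : 'I_3 -> R) : \sum_i f i = f i0 + f i1 + f i2.
Proof.
rewrite !big_ord_recl big_ord0 addr0 addrA.
by congr (_ + f _ + f _); apply: val_inj.
Qed.

Lemma dotE u v : dot u v = u 0 i0 * v 0 i0 + u 0 i1 * v 0 i1 + u 0 i2 * v 0 i2.
Proof. exact: sum3. Qed.

Lemma dotC u v : dot u v = dot v u.
Proof. by rewrite !dotE; ring. Qed.

Lemma dotDl u v w : dot (u + v) w = dot u w + dot v w.
Proof. by rewrite !dotE !mxE; ring. Qed.

Lemma dotBl u v w : dot (u - v) w = dot u w - dot v w.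
Proof. by rewrite !dotE !mxE; ring. Qed.

Lemma dotZl a u w : dot (a *: u) w = a * dot u w.
Proof. by rewrite !dotE !mxE; ring. Qed.

Lemma dotNl u w : dot (- u) w = - dot u w.
Proof. by rewrite !dotE !mxE; ring. Qed.

Lemma dot0l w : dot 0 w = 0.
Proof. by rewrite !dotE !mxE; ring. Qed.

Lemma dotDr u v w : dot w (u + v) = dot w u + dot w v.
Proof. by rewrite !(dotC w) dotDl. Qed.

Lemma dotBr u v w : dot w (u - v) = dot w u - dot w v.
Proof. by rewrite !(dotC w) dotBl. Qed.

Lemma dotZr a u w : dot w (a *: u) = a * dot w u.
Proof. by rewrite !(dotC w) dotZl. Qed.

Lemma dotNr u w : dot w (- u) = - dot w u.
Proof. by rewrite !(dotC w) dotNl. Qed.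

Definition dot_linear := (dotDl, dotDr, dotBl, dotBr, dotZl, dotZr, dotNl, dotNr).

Lemma dot_ge0 u : 0 <= dot u u.
Proof. by rewrite dotE -!expr2 !addr_ge0// sqr_ge0. Qed.

Lemma enorm_ge0 u : 0 <= enorm u.
Proof. exact: sqrtr_ge0. Qed.

Lemma enormK u : dot u u = enorm u ^+ 2.
Proof. by rewrite sqr_sqrtr// dot_ge0. Qed.

Lemma enorm0 : enorm (0 : 'rV[R]_3) = 0.
Proof. by rewrite /enorm dot0l sqrtr0. Qed.

Lemma enorm_le_sqr u a : 0 <= a -> (enorm u <= a) = (dot u u <= a ^+ 2).
Proof. by move=> a0; rewrite enormK ler_sqr// nnegrE enorm_ge0. Qed.

Lemma enormZ a u : enorm (a *: u) = `|a| * enorm u.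
Proof.
by rewrite /enorm dotZl dotZr mulrA -expr2 sqrtrM ?sqr_ge0// sqrtr_sqr.
Qed.

Lemma enormN u : enorm (- u) = enorm u.
Proof. by rewrite -scaleN1r enormZ normrN1 mul1r. Qed.

Lemma enormBC u v : enorm (u - v) = enorm (v - u).
Proof. by rewrite -enormN opprB. Qed.

Lemma enorm_eq0 u : (enorm u == 0) = (u == 0).
Proof.
apply/eqP/eqP => [u0|->]; last exact: enorm0.
have : dot u u = 0 by rewrite enormK u0 expr0n.
move/eqP; rewrite dotE -!expr2 !paddr_eq0 ?addr_ge0 ?sqr_ge0// !sqrf_eq0.
move=> /andP[/andP[/eqP a /eqP b] /eqP c].
by apply/rowP; apply: ord3P; rewrite mxE.
Qed.

Lemma enorm_gt0 u : (0 < enorm u) = (u != 0).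
Proof. by rewrite lt_neqAle enorm_ge0 andbT eq_sym enorm_eq0. Qed.

Lemma addrKl x w : x + w - x = w.
Proof. by rewrite addrAC subrr add0r. Qed.

Definition cross u v : 'rV[R]_3 := \row_(i < 3)
  [eta (fun=> 0) with i0 |-> u 0 i1 * v 0 i2 - u 0 i2 * v 0 i1,
                      i1 |-> u 0 i2 * v 0 i0 - u 0 i0 * v 0 i2,
                      i2 |-> u 0 i0 * v 0 i1 - u 0 i1 * v 0 i0] i.

Lemma cross0E u v : cross u v 0 i0 = u 0 i1 * v 0 i2 - u 0 i2 * v 0 i1.
Proof. by rewrite mxE. Qed.

Lemma cross1E u v : cross u v 0 i1 = u 0 i2 * v 0 i0 - u 0 i0 * v 0 i2.
Proof. by rewrite mxE. Qed.

Lemma cross2E u v : cross u v 0 i2 = u 0 i0 * v 0 i1 - u 0 i1 * v 0 i0.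
Proof. by rewrite mxE. Qed.

Definition det3 u v w : R := dot (cross u v) w.

Lemma det3E u v w : det3 u v w =
  (u 0 i1 * v 0 i2 - u 0 i2 * v 0 i1) * w 0 i0 +
  (u 0 i2 * v 0 i0 - u 0 i0 * v 0 i2) * w 0 i1 +
  (u 0 i0 * v 0 i1 - u 0 i1 * v 0 i0) * w 0 i2.
Proof. by rewrite /det3 dotE cross0E cross1E cross2E. Qed.

Lemma lagrange_identity u v :
  dot (cross u v) (cross u v) = dot u u * dot v v - dot u v ^+ 2.
Proof. by rewrite !dotE cross0E cross1E cross2E; ring. Qed.

(** By the Lagrange identity the defect in the squared inequality is the squared
   norm of the cross product. *)
Lemma dot_le u v : `|dot u v| <= enorm u * enorm v.
Proof.
rewrite -ler_sqr ?nnegrE ?mulr_ge0 ?enorm_ge0// real_normK ?num_real//.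
by rewrite exprMn -!enormK -subr_ge0 -lagrange_identity dot_ge0.
Qed.

Lemma enormD u v : enorm (u + v) <= enorm u + enorm v.
Proof.
rewrite enorm_le_sqr ?addr_ge0 ?enorm_ge0// !dot_linear !enormK (dotC v u).
have := dot_le u v; rewrite ler_norml => /andP[_ h]; nra.
Qed.

Lemma enormB u v : enorm (u - v) <= enorm u + enorm v.
Proof. by rewrite (le_trans (enormD _ _))// enormN. Qed.

Lemma enorm_dist3 x y z : enorm (x - z) <= enorm (x - y) + enorm (y - z).
Proof. by rewrite (le_trans _ (enormD _ _))// addrA subrK. Qed.

Lemma coord_le_enorm u i : `|u 0 i| <= enorm u.
Proof.
rewrite -ler_sqr ?nnegrE ?enorm_ge0// real_normK ?num_real// -enormK dotE.
have h a b c : 0 <= a * a + b * b + c * c by nra.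
by move: i; apply: ord3P; nra.
Qed.

Lemma enorm_le_coord u a : (forall i, `|u 0 i| <= a) -> enorm u <= 2 * a.
Proof.
move=> h; have a0 : 0 <= a by rewrite (le_trans _ (h 0)).
rewrite enorm_le_sqr; last by nra.
have g i : u 0 i * u 0 i <= a ^+ 2.
  by rewrite -expr2 -(real_normK (num_real _)) ler_sqr ?nnegrE// h.
rewrite dotE; have := g i0; have := g i1; have := g i2; nra.
Qed.

Lemma enorm_cross_le u v : enorm (cross u v) <= enorm u * enorm v.
Proof.
rewrite enorm_le_sqr ?mulr_ge0 ?enorm_ge0// lagrange_identity.
by rewrite !enormK exprMn gerBl sqr_ge0.
Qed.

Lemma det3_le u v w : `|det3 u v w| <= enorm u * enorm v * enorm w.
Proof.
by rewrite (le_trans (dot_le _ _))// ler_wpM2r ?enorm_ge0// enorm_cross_le.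
Qed.

(** The difference expands into the seven terms of [det3] that contain at least
   one of the small vectors. *)
Lemma det3_perturb u v w u' v' w' a b : 0 <= b <= a ->
  enorm u <= a -> enorm v <= a -> enorm w <= a ->
  enorm u' <= b -> enorm v' <= b -> enorm w' <= b ->
  `|det3 (u + u') (v + v') (w + w') - det3 u v w| <= 7 * a ^+ 2 * b.
Proof.
move=> /andP[b0 ba] hu hv hw hu' hv' hw'.
have -> : det3 (u + u') (v + v') (w + w') - det3 u v w =
  det3 u' v w + (det3 u v' w + (det3 u v w' + (det3 u' v' w + (det3 u' v w' +
   (det3 u v' w' + det3 u' v' w'))))).
  by rewrite !det3E !mxE; ring.
have a0 : 0 <= a by rewrite (le_trans b0).
have ex3 (x y z : 'rV[R]_3) (c1 c2 c3 : R) : enorm x <= c1 -> enorm y <= c2 -> enorm z <= c3 ->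
    c1 * c2 * c3 <= a ^+ 2 * b -> `|det3 x y z| <= a ^+ 2 * b.
  move=> h1 h2 h3 h; apply: le_trans (det3_le _ _ _) (le_trans _ h).
  by rewrite !ler_pM ?mulr_ge0 ?enorm_ge0.
have b2 : b * b <= a * b by rewrite ler_wpM2r.
have b3 : b * b <= a * a by rewrite ler_pM.
rewrite (_ : 7 * a ^+ 2 * b = a ^+ 2 * b + (a ^+ 2 * b + (a ^+ 2 * b + (a ^+ 2 * b +
  (a ^+ 2 * b + (a ^+ 2 * b + a ^+ 2 * b)))))); last by ring.
have tri (x y c d : R) : `|x| <= c -> `|y| <= d -> `|x + y| <= c + d.
  by move=> hx hy; rewrite (le_trans (ler_normD _ _))// lerD.
apply/tri; first by apply: (ex3 _ _ _ b a a) => //; nra.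
apply/tri; first by apply: (ex3 _ _ _ a b a) => //; nra.
apply/tri; first by apply: (ex3 _ _ _ a a b) => //; nra.
apply/tri; first by apply: (ex3 _ _ _ b b a) => //; nra.
apply/tri; first by apply: (ex3 _ _ _ b a b) => //; nra.
apply/tri; first by apply: (ex3 _ _ _ a b b) => //; nra.
by apply: (ex3 _ _ _ b b b) => //; nra.
Qed.

(** Cramer's rule, in the form of an expansion in the basis dual to [u, v, x]; it
   shows that only the zero vector is orthogonal to three independent ones. *)
Lemma det3_dual_basis u v x w : det3 u v x *: w =
  dot w u *: cross v x + dot w v *: cross x u + dot w x *: cross u v.
Proof.
have sc k z (i : 'I_3) : (k *: z) 0 i = k * z 0 i by rewrite mxE.
have ad y z (i : 'I_3) : (y + z) 0 i = y 0 i + z 0 i by rewrite mxE.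
apply/rowP; apply: ord3P; rewrite !ad !sc ?cross0E ?cross1E ?cross2E det3E !dotE;
  ring.
Qed.

(** The last condition fixes the orientation, and with it the side of the plane
   of [e1 + s *: n] and [e2 + t *: n] on which [n] lies. *)
Definition frame e1 e2 n : Prop :=
  [/\ [/\ dot e1 e1 = 1, dot e2 e2 = 1 & dot n n = 1],
      [/\ dot e1 e2 = 0, dot e1 n = 0 & dot e2 n = 0] & det3 e1 e2 n = 1].

Lemma frame_exists n : enorm n = 1 -> exists e1 e2, frame e1 e2 n.
Proof.
move=> n1; have nn : dot n n = 1 by rewrite enormK n1 expr1n.
have [e [e1 en]] : exists e, dot e e = 1 /\ dot e n = 0.
  have [f [f0 fn]] : exists f, f != 0 /\ dot f n = 0.
    have [h|h] := eqVneq (n 0 i0) 0.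
      exists (\row_i (i == i0)%:R); split; last first.
        by rewrite dotE !mxE/= h; ring.
      apply/eqP => /rowP/(_ i0); rewrite !mxE/= => /eqP; by rewrite oner_eq0.
    exists (\row_i [eta (fun=> 0) with i0 |-> - n 0 i1, i1 |-> n 0 i0] i); split.
      apply/eqP => /rowP/(_ i1); rewrite !mxE/= => /eqP; by rewrite (negbTE h).
    by rewrite dotE !mxE/=; ring.
  exists ((enorm f)^-1 *: f); rewrite !dot_linear fn mulr0 enormK; split=> //.
  by field; rewrite enorm_eq0.
exists e, (cross n e).
have lag := lagrange_identity n e.
have ne : dot n e = 0 by rewrite dotC.
have d : det3 e (cross n e) n = dot (cross n e) (cross n e).
  by rewrite det3E dotE cross0E cross1E cross2E; ring.
split; [split|split|]=> //.
- by rewrite lag nn e1 ne; ring.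
- by rewrite dotE cross0E cross1E cross2E; ring.
- by rewrite dotE cross0E cross1E cross2E; ring.
- by rewrite d lag nn e1 ne; ring.
Qed.

Lemma eball_center x r : 0 <= r -> eball x r x.
Proof. by move=> r0; rewrite /eball/= subrr enorm0. Qed.

Lemma sub_eball x y r s : enorm (x - y) + r <= s -> eball x r `<=` eball y s.
Proof.
move=> h z; rewrite /eball/= => zx.
by apply: le_trans (enorm_dist3 z x y) _; lra.
Qed.

End euclidean_space.
(** * The topology of three-space in terms of the Euclidean norm *)

Section topology_bridge.
Variable R : realType.
Implicit Types (S F : set 'rV[R]_3) (x y z : 'rV[R]_3).

Lemma nbhs_eball x (A : set 'rV[R]_3) : nbhs x A ->
  exists2 r : R, 0 < r & eball x r `<=` A.
Proof.
move=> /nbhs_ballP[e /= e0 eA]; exists (e / 2); first by rewrite divr_gt0.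
move=> y; rewrite /eball/= => yx; apply: eA.
rewrite -ball_normE/=; apply: (@le_lt_trans _ _ (e / 2)); last first.
  by rewrite ltr_pdivrMr// ltr_pMr// ltrDl.
rewrite /Num.Def.normr/= mx_normrE; apply: bigmax_le => [|[i j] _ /=].
  by rewrite divr_ge0// ltW.
by rewrite ord1 (le_trans (coord_le_enorm _ _))// enormBC.
Qed.

Lemma eball_nbhs x (r : R) : 0 < r -> nbhs x (eball x r).
Proof.
move=> r0; apply/nbhs_ballP; exists (r / 2) => /=; first by rewrite divr_gt0.
move=> y; rewrite -ball_normE/= => xy; rewrite /eball/= enormBC.
rewrite (_ : r = 2 * (r / 2)); last by field.
apply: enorm_le_coord => i; apply: le_trans (ltW xy).
by rewrite [leRHS]/Num.Def.normr/= mx_normrE; apply: (le_bigmax _ (fun ij => `|(x - y) ij.1 ij.2|) (0, i)).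
Qed.

Lemma closureE_enorm S x :
  closure S x <-> forall r : R, 0 < r -> exists2 y, S y & enorm (x - y) <= r.
Proof.
split=> [cS r r0|h B /nbhs_eball[r r0 rB]].
  have [y [Sy xy]] := cS _ (eball_nbhs x r0).
  by exists y => //; rewrite enormBC.
have [y Sy xy] := h _ r0; exists y; split=> //; apply: rB.
by rewrite /eball/= enormBC.
Qed.

Lemma dist_to_has_inf z S : S !=set0 -> has_inf [set enorm (z - y) | y in S].
Proof.
move=> [y Sy]; split; first by exists (enorm (z - y)), y.
by exists 0 => _ [w _ <-]; exact: enorm_ge0.
Qed.

Lemma dist_to_le z S y : S y -> dist_to z S <= enorm (z - y).
Proof.
move=> Sy; apply: ge_inf; last by exists y.
by exists 0 => _ [w _ <-]; exact: enorm_ge0.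
Qed.

Lemma dist_to_lipschitz S y z : S !=set0 ->
  `|dist_to y S - dist_to z S| <= enorm (y - z).
Proof.
move=> S0; have h u v : dist_to u S <= enorm (u - v) + dist_to v S.
  rewrite -lerBlDl; apply: lb_le_inf => [|_ [w Sw <-]].
    by have [w Sw] := S0; exists (enorm (v - w)), w.
  by rewrite lerBlDl (le_trans (dist_to_le u Sw)) ?enorm_dist3.
have := h y z; have := h z y; rewrite (enormBC z y) ler_norml; lra.
Qed.

Lemma closed_dist_to F : closed F -> F !=set0 -> [set y | dist_to y F <= 0] = F.
Proof.
move=> cF F0; apply/seteqP; split=> y /=; last first.
  by move=> Fy; rewrite (le_trans (dist_to_le y Fy))// subrr enorm0.
move=> d0; apply: cF; apply/closureE_enorm => r r0.
have [|_ [z Fz <-] zr] := @inf_adherent _ [set enorm (y - z) | z in F] r r0.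
  exact: dist_to_has_inf.
by exists z => //; rewrite (le_trans (ltW zr))// gerDr.
Qed.

Lemma eball_closed x (r : R) : closed (eball x r).
Proof.
move=> y /closureE_enorm cy; rewrite /eball/=; apply/ler_addgt0Pr => e e0.
have [z xz yz] := cy _ e0; rewrite /eball/= in xz.
by apply: le_trans (enorm_dist3 y z x) _; rewrite addrC lerD.
Qed.

End topology_bridge.

(** * Measurability of closed sets for the Hausdorff measure *)

Section hausdorff_theory.
Variable R : realType.
Implicit Types (A B F X : set 'rV[R]_3) (x y z : 'rV[R]_3).
Local Open Scope ereal_scope.
Local Notation H2 := (@hausdorff2 R).

Lemma enorm_le_ediam A y z : A y -> A z -> (enorm (y - z))%:E <= ediam A.
Proof.
move=> Ay Az; rewrite /ediam le_max; apply/orP; right.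
by apply: ereal_sup_ubound; exists (y, z).
Qed.

(** A set of small diameter meets at most one of two sets at positive distance,
   so a fine cover of the union splits into covers of the two parts. *)
Lemma hausdorff2_delta_separated A B (tau delta : R) : (delta < tau)%R ->
  (forall a b, A a -> B b -> (tau <= enorm (a - b))%R) ->
  hausdorff2_delta delta A + hausdorff2_delta delta B <=
  hausdorff2_delta delta (A `|` B).
Proof.
move=> dtau sep; apply: le_ereal_inf_tmp => _ [C [dC ABC] <-].
pose CA i := if `[< C i `&` A !=set0 >] then C i else set0.
pose CB i := if `[< C i `&` A !=set0 >] then set0 else C i.
have sA : hausdorff2_delta delta A <= \sum_(i <oo) hausdorff2_weight (CA i).
  apply: ereal_inf_lbound; exists CA => //; split=> [i|a Aa].
    rewrite /CA; case: asboolP => _ //.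
    by rewrite ediam0 (le_trans _ (dC i))// ediam_ge0.
  have [i _ Ci] : (\bigcup_i C i) a by apply: ABC; left.
  by exists i => //; rewrite /CA; case: asboolP => // -[]; exists a.
have sB : hausdorff2_delta delta B <= \sum_(i <oo) hausdorff2_weight (CB i).
  apply: ereal_inf_lbound; exists CB => //; split=> [i|b Bb].
    rewrite /CB; case: asboolP => _ //.
    by rewrite ediam0 (le_trans _ (dC i))// ediam_ge0.
  have [i _ Ci] : (\bigcup_i C i) b by apply: ABC; right.
  exists i => //; rewrite /CB; case: asboolP => // -[a [Ca Aa]].
  have := le_trans (enorm_le_ediam Ca Ci) (dC i); rewrite lee_fin.
  by have := sep _ _ Aa Bb; lra.
apply: le_trans (leeD sA sB) _.
rewrite -nneseriesD; try by move=> *; exact: hausdorff2_weight_ge0.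
apply: lee_nneseries => [i _ _|i _]; first by rewrite adde_ge0 ?hausdorff2_weight_ge0.
have w0 : hausdorff2_weight (set0 : set 'rV[R]_3) = 0.
  by rewrite /hausdorff2_weight ediam0 expe2 !mule0.
by rewrite /CA /CB; case: asboolP => _; rewrite w0 ?adde0 ?add0e.
Qed.

Lemma hausdorff2_delta_anti A (d1 d2 : R) : (d1 <= d2)%R ->
  hausdorff2_delta d2 A <= hausdorff2_delta d1 A.
Proof.
move=> d12; apply: ereal_inf_le_tmp => _ [C [dC AC] <-]; exists C => //.
by split=> // i; rewrite (le_trans (dC i))// lee_fin.
Qed.

Lemma hausdorff2_delta_le A (d : R) : (0 < d)%R -> hausdorff2_delta d A <= H2 A.
Proof. by move=> d0; apply: ereal_sup_ubound; exists d. Qed.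

(** The Hausdorff outer measure is a metric outer measure, which is the property
   that makes closed sets measurable. *)
Lemma hausdorff2_separated A B (tau : R) : (0 < tau)%R ->
  (forall a b, A a -> B b -> (tau <= enorm (a - b))%R) ->
  H2 A + H2 B <= H2 (A `|` B).
Proof.
move=> tau0 sep.
have [->|ABfin] := eqVneq (H2 (A `|` B)) +oo; first by rewrite leey.
have AB : H2 (A `|` B) < +oo by rewrite ltey.
have fin X : X `<=` A `|` B -> H2 X \is a fin_num.
  move=> XAB; rewrite ge0_fin_numE ?hausdorff2_outer_ge0//.
  exact: le_lt_trans (le_hausdorff2 XAB) AB.
have key d : (0 < d)%R -> hausdorff2_delta d A + hausdorff2_delta d B <= H2 (A `|` B).
  move=> d0; pose d' := Num.min d (tau / 2)%R.
  have d'0 : (0 < d')%R by rewrite lt_min d0 divr_gt0.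
  have d't : (d' < tau)%R.
    by rewrite gt_min; apply/orP; right; rewrite ltr_pdivrMr// ltr_pMr// ltrDl.
  apply: le_trans (hausdorff2_delta_le _ d'0).
  apply: le_trans (hausdorff2_delta_separated d't sep).
  by rewrite leeD// hausdorff2_delta_anti// ge_min lexx.
have fA := fin A (@subsetUl _ A B).
have fB := fin B (@subsetUr _ A B).
rewrite -leeBrDr//; apply: ge_ereal_sup => _ [d d0 <-].
rewrite leeBrDr// addeC.
have fdA : hausdorff2_delta d A \is a fin_num.
  rewrite ge0_fin_numE ?hausdorff2_delta_ge0//.
  by rewrite (le_lt_trans (hausdorff2_delta_le _ d0))// -ge0_fin_numE ?hausdorff2_outer_ge0.
rewrite -leeBrDr//; apply: ge_ereal_sup => _ [d2 d20 <-]; rewrite leeBrDr//.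
pose m := Num.min d d2.
have m0 : (0 < m)%R by rewrite lt_min d0 d20.
apply: le_trans (key _ m0); rewrite addeC leeD// hausdorff2_delta_anti//.
  by rewrite ge_min lexx.
by rewrite ge_min lexx orbT.
Qed.

(** The shells between consecutive level sets of [g] are separated as soon as
   they are not adjacent; this bounds the sum of their measures, so that the
   superlevel sets exhaust the complement also in measure. *)
Lemma caratheodory_sublevel (g : 'rV[R]_3 -> R) :
  (forall y z, (`|g y - g z| <= enorm (y - z))%R) ->
  (hausdorff2_outer R).-caratheodory [set y | (g y <= 0)%R].
Proof.
move=> glip; apply: le_caratheodory_measurable => X.
rewrite -[_ (X `&` _)]/(H2 _) -[hausdorff2_outer _ _]/(H2 _).
rewrite -[X in _ <= X]/(H2 X) -[X in _ + X]/(H2 (X `&` _)).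
have [->|Xfin] := eqVneq (H2 X) +oo; first by rewrite leey.
have fX : H2 X \is a fin_num by rewrite ge0_fin_numE ?hausdorff2_outer_ge0// ltey.
pose l k : R := (k.+1%:R^-1)%R.
have l0 k : (0 < l k)%R by rewrite invr_gt0.
have lS k : (l k.+1 < l k)%R by rewrite ltf_pV2 ?posrE// ltr_nat.
pose A k := X `&` [set y | (l k <= g y)%R].
pose Sh k := X `&` [set y | (l k.+1 <= g y < l k)%R].
have lipsep y z a b : (a <= g y)%R -> (g z <= b)%R -> (a - b <= enorm (y - z))%R.
  move=> ay zb; apply: le_trans (glip y z).
  by apply: le_trans (ler_norm _); rewrite lerB.
(* The set [Sh N.+1] is separated from [A N]; together they are
   contained in [A N.+2], so the two terms of the bound advance in turn. *)
have shells N : \sum_(0 <= j < N) H2 (Sh j.+1) <= H2 (A N) + H2 (A N.+1).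
  elim: N => [|N IH]; first by rewrite big_nil adde_ge0 ?hausdorff2_outer_ge0.
  rewrite big_nat_recr//=; apply: le_trans (leeD IH (lexx _)) _.
  rewrite -addeA addeCA leeD2l//.
  apply: le_trans (@hausdorff2_separated _ _ (l N - l N.+1) _ _) _.
  - by rewrite subr_gt0.
  - by move=> a b [_ /= la] [_ /= /andP[_ lb]]; apply: lipsep => //; exact: ltW.
  apply: le_hausdorff2 => y [[Xy /= ly]|[Xy /= /andP[ly _]]]; split=> //=.
  by apply: le_trans ly; rewrite (le_trans (ltW (lS _)))// ltW.
have sfin : \sum_(0 <= j <oo) H2 (Sh j.+1) < +oo.
  apply: (@le_lt_trans _ _ (H2 X + H2 X)); last by rewrite lte_add_pinfty// -ge0_fin_numE ?hausdorff2_outer_ge0.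
  apply: lime_le; first by apply: is_cvg_nneseries => *; exact: hausdorff2_outer_ge0.
  apply: nearW => N; apply: le_trans (shells N) _.
  by rewrite leeD// le_hausdorff2// => y [].
have tail := nneseries_tail_cvg sfin (fun k _ => hausdorff2_outer_ge0 (Sh k.+1)).
apply/lee_addgt0Pr => e e0.
have e0' : 0 < e%:E by rewrite lte_fin.
have [N _ /(_ N (leqnn N)) /= tN] := tail _ (open_ereal_lt' e0').
(* A point outside the sublevel set lies in [A N.+1] or in a later shell, whose
   lower end is the first level that the value of [g] reaches. *)
have cov : X `&` ~` [set y | (g y <= 0)%R] `<=`
    A N.+1 `|` \bigcup_(n in ~` `I_N) Sh n.+1.
  move=> y [Xy /= /negP]; rewrite -ltNge => gy.
  have [lg|gl] := leP (l N.+1) (g y); first by left.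
  right; have [k kg] : exists k, (l k <= g y)%R.
    exists (Num.truncn (g y)^-1); rewrite /l -[leRHS]invrK lef_pV2 ?posrE ?invr_gt0//.
    by rewrite ltW// truncnS_gt.
  pose P k := (l k <= g y)%R.
  have exP : exists k, P k by exists k.
  have := ex_minnP exP; case=> m Pm minm.
  have Nm : (N.+1 < m)%N.
    rewrite ltnNge; apply/negP => mN; have : (l N.+1 <= l m)%R.
      by rewrite lef_pV2 ?posrE// ler_nat.
    by move: Pm; rewrite /P; lra.
  exists m.-2.
    by apply/negP; rewrite /= -leqNgt; case: m Nm {Pm minm} => [|[]].
  split=> //=; have -> : m.-2.+2 = m by case: m Nm {Pm minm} => [|[]].
  rewrite -/(P m) Pm/= ltNge; apply/negP => /minm.
  by case: m Nm {Pm minm} => [|[|m]]//= _; rewrite ltnn.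
apply: (@le_trans _ _ (H2 (X `&` [set y | (g y <= 0)%R]) + (H2 (A N.+1) + e%:E))).
  rewrite leeD2l//; apply: le_trans (le_hausdorff2 cov) _.
  apply: le_trans (outer_measureU2 (hausdorff2_outer R) _ _) _.
  rewrite leeD2l//; apply: le_trans (ltW tN).
  exact: (outer_measure_sigma_subadditive_tail (hausdorff2_outer R)).
rewrite addeA leeD2r//.
apply: le_trans (@hausdorff2_separated _ _ (l N.+1) (l0 _) _) _.
  move=> a b [_ /= ga] [_ /= gb]; rewrite enormBC.
  by rewrite -[leLHS]subr0; apply: lipsep.
by apply: le_hausdorff2 => y [] [].
Qed.

Lemma closed_caratheodory F : closed F -> (hausdorff2_outer R).-caratheodory F.
Proof.
move=> cF; have [->|/set0P F0] := eqVneq F set0.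
  exact: caratheodory_measurable_set0.
rewrite -(closed_dist_to cF F0); apply: caratheodory_sublevel => y z.
exact: dist_to_lipschitz.
Qed.

(** The integral of a nonnegative function is a supremum over the simple
   functions below it, among which is [a] times the indicator of [D]. *)
Lemma integral_ge_cst (D S : set 'rV[R]_3) (f : 'rV[R]_3 -> \bar R) (a m : R) :
  closed D -> D `<=` S -> (0 <= a)%R -> m%:E <= H2 D ->
  (forall x, 0 <= f x) -> (forall x, D x -> a%:E <= f x) ->
  (a * m)%:E <= \int[hausdorff2_measure R]_(x in S) f x.
Proof.
move=> cD DS a0 mD f0 fa.
have mmD : measurable (D : set (caratheodory_type (hausdorff2_outer R))).
  exact: closed_caratheodory.
apply: (@le_trans _ _ (\int[hausdorff2_measure R]_(x in D) (cst a%:E) x)).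
  by rewrite integral_cst// EFinM lee_wpmul2l ?lee_fin.
rewrite ge0_integralE; last by move=> x _; rewrite lee_fin.
rewrite ge0_integralE//; apply: ge_ereal_sup => _ [h/= hD <-].
apply: ereal_sup_ubound; exists h => //= x; apply: le_trans (hD x) _.
rewrite /patch; case: ifPn => [|_].
  by rewrite inE => Dx; rewrite ifT ?fa// inE; exact: DS.
by case: ifP.
Qed.

End hausdorff_theory.
(** * Hausdorff measure and projections *)

Section projection.
Variable R : realType.
Implicit Types (A : set 'rV[R]_3) (x y z : 'rV[R]_3).
Local Open Scope ereal_scope.
Local Notation H2 := (@hausdorff2 R).

(** A square that contains the projection of [C] to the plane of [e1] and [e2]:
   any point of the projection is the centre, as projections do not increase
   the diameter. *)
Definition shadow_box (x e1 e2 : 'rV[R]_3) (C : set 'rV[R]_3) : set (R * R) :=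
  if pselect (C !=set0) is left h then
    let c := projT1 (cid h) in let d := fine (ediam C) in
    `[(dot (c - x) e1 - d)%R, (dot (c - x) e1 + d)%R] `*`
    `[(dot (c - x) e2 - d)%R, (dot (c - x) e2 + d)%R]
  else set0.

Let lam2 : {measure set (measurableTypeR R * measurableTypeR R) -> \bar R} :=
  (@lebesgue_measure R \x @lebesgue_measure R).

Let lam2_rect (a b c d : R) : (a <= b)%R -> (c <= d)%R ->
  lam2 (`[a, b] `*` `[c, d]) = ((b - a) * (d - c))%:E.
Proof.
have itvE (u v : R) : (u <= v)%R -> lebesgue_measure (`[u, v] : set R) = (v - u)%:E.
  move=> uv; have -> := lebesgue_measure_itv `[u, v].
  by rewrite /= lte_fin; case: ltgtP uv => // -> _; rewrite subrr.
by move=> ab cd; rewrite EFinM -!itvE//; exact: product_measure1E.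
Qed.

(** The shadows of the sets of a cover form a cover of the square [-a, a]^2, and
   the area of a shadow is [16 / pi] times the weight of the set; so the measure
   of [A] is bounded below by the planar Lebesgue measure. *)
Lemma hausdorff2_ge_square A x (e1 e2 : 'rV[R]_3) (a : R) : (0 < a)%R ->
  enorm e1 = 1%R -> enorm e2 = 1%R ->
  (forall s t : R, (`|s| <= a)%R -> (`|t| <= a)%R ->
    exists y, [/\ A y, dot (y - x) e1 = s & dot (y - x) e2 = t]) ->
  (pi / 4 * a ^+ 2)%:E <= H2 A.
Proof.
move=> a0 n1 n2 hA; apply: le_trans (hausdorff2_delta_le A (@ltr01 R)).
apply: le_ereal_inf_tmp => _ [C [dC AC] <-].
have pi4 : (0 < pi / 4 :> R)%R by rewrite divr_gt0// pi_gt0.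
have pi0 : pi != 0%R :> R by rewrite gt_eqF// pi_gt0.
have dfin i : ediam (C i) \is a fin_num.
  by rewrite ge0_fin_numE ?ediam_ge0// (le_lt_trans (dC i))// ltry.
have d0 i : (0 <= fine (ediam (C i)))%R by rewrite fine_ge0// ediam_ge0.
have mB i : measurable (shadow_box x e1 e2 (C i)).
  rewrite /shadow_box; case: pselect => // h; exact: measurableX.
have lB i : lam2 (shadow_box x e1 e2 (C i)) <=
    (4 / (pi / 4))%:E * hausdorff2_weight (C i).
  rewrite /shadow_box; case: pselect => [h|_]; last first.
    rewrite measure0 mule_ge0 ?hausdorff2_weight_ge0// lee_fin.
    by rewrite divr_ge0// ltW.
  rewrite lam2_rect; last 2 first.
  - by have := d0 i; lra.
  - by have := d0 i; lra.
  rewrite /hausdorff2_weight -(fineK (dfin i)) -EFin_expe -!EFinM lee_fin.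
  rewrite le_eqVlt; apply/orP; left; apply/eqP; move: pi0; move: (pi : R) => q q0; by field.
have sub : `[(- a)%R, a] `*` `[(- a)%R, a] `<=` \bigcup_i shadow_box x e1 e2 (C i).
  move=> [s t] /= [hs ht].
  rewrite !in_itv/= in hs ht.
  have [y [Ay ys yt]] : exists y, [/\ A y, dot (y - x) e1 = s & dot (y - x) e2 = t].
    by apply: hA; rewrite ler_norml.
  have [i _ Ci] := AC _ Ay; exists i => //; rewrite /shadow_box.
  case: pselect => [h|[]]; last by exists y.
  case: (cid h) => c /= Cc; rewrite !in_itv/=.
  have cy : (enorm (y - c) <= fine (ediam (C i)))%R.
    by rewrite -lee_fin fineK// enorm_le_ediam.
  have pr e : enorm e = 1%R -> (`|dot (y - x) e - dot (c - x) e| <= fine (ediam (C i)))%R.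
    move=> ne; rewrite -dotBl opprB addrA subrK.
    by apply: le_trans (dot_le _ _) _; rewrite ne mulr1.
  have := pr _ n1; have := pr _ n2; rewrite ys yt !ler_distl.
  by move=> /andP[p1 p2] /andP[p3 p4]; split; apply/andP; split.
have msq : measurable (`[(- a)%R, a] `*` `[(- a)%R, a] : set (R * R)).
  exact: measurableX.
have := measure_sigma_subadditive lam2 mB msq sub.
have aa : (- a <= a)%R by lra.
rewrite lam2_rect// => h.
have {}h := le_trans h (lee_nneseries (fun i _ _ => measure_ge0 lam2 _) (fun i _ => lB i)).
rewrite nneseriesZl in h; last by move=> i _; exact: hausdorff2_weight_ge0.
move: h; set W := (X in _ * X) => h.
rewrite -(@lee_pmul2l _ (4 / (pi / 4))%:E)//; last by rewrite lte_fin divr_gt0.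
apply: le_trans h; rewrite -EFinM lee_fin le_eqVlt; apply/orP; left; apply/eqP.
by move: pi0; move: (pi : R) => q q0; field.
Qed.

End projection.

(** * The energy of thick tetrahedra *)

Section menger_kernel_lower_bound.
Variable R : realType.
Implicit Types (x y z : 'rV[R]_3).

Lemma det_mx33 (M : 'M[R]_3) : \det M =
  M 0 0 * (M 1 1 * M 2%:R 2%:R - M 1 2%:R * M 2%:R 1)
  - M 0 1 * (M 1 0 * M 2%:R 2%:R - M 1 2%:R * M 2%:R 0)
  + M 0 2%:R * (M 1 0 * M 2%:R 1 - M 1 1 * M 2%:R 0).
Proof.
rewrite (expand_det_row _ 0) sum3 /cofactor.
rewrite !(expand_det_row _ 0) !big_ord_recl !big_ord0 /cofactor !det_mx11 !mxE/=.
have e (i j : 'I_3) : nat_of_ord i = j -> M^~ i = M^~ j by move/val_inj->.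
have e0 (i j : 'I_3) : nat_of_ord i = j -> M i = M j by move/val_inj->.
rewrite ![M (lift 0 0)](e0 _ 1)// ![M (lift 0 (lift _ _))](e0 _ 2%:R)//.
have {}e (k i j : 'I_3) : nat_of_ord i = j -> M k i = M k j by move/val_inj->.
rewrite ![M _ (lift 0 ord0)](e _ _ 1)// ![M _ (lift 0 (lift ord0 _))](e _ _ 2%:R)//.
rewrite ![M _ (lift 1 ord0)](e _ _ 0)// ![M _ (lift 1 (lift ord0 _))](e _ _ 2%:R)//.
rewrite ![M _ (lift 2%:R ord0)](e _ _ 0)// ![M _ (lift 2%:R (lift ord0 _))](e _ _ 1)//.
rewrite ![M _ (lift 0 (lift _ _))](e _ _ 1)// ![M _ (lift 1 (lift _ _))](e _ _ 0)//.
rewrite ![M _ (lift 2%:R (lift _ _))](e _ _ 0)//.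
rewrite (_ : (0 + (1 %% 3 + 1 %% 3) %% 3 = 2)%N)// (_ : (0 + 1 %% 3 = 1)%N)//.
by rewrite addn0; ring.
Qed.

Lemma det_edge_matrix (a b c d : 'rV[R]_3) :
  \det (edge_matrix [tuple a; b; c; d]) = det3 (b - a) (c - a) (d - a).
Proof. by rewrite det_mx33 !mxE !(tnth_nth 0)/= det3E !mxE; ring. Qed.

Lemma triangle_area_ge0 a b c : 0 <= triangle_area a b c :> R.
Proof. by rewrite /triangle_area divr_ge0// sqrtr_ge0. Qed.

Lemma triangle_areaE a b c :
  triangle_area a b c = enorm (cross (b - a) (c - a)) / 2 :> R.
Proof. by rewrite /triangle_area -lagrange_identity. Qed.

Lemma triangle_area_le a b c (r : R) : enorm (b - a) <= r -> enorm (c - a) <= r ->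
  triangle_area a b c <= r ^+ 2 / 2.
Proof.
move=> ba ca; rewrite triangle_areaE ler_pM2r ?invr_gt0//.
apply: le_trans (enorm_cross_le _ _) _.
by rewrite expr2 ler_pM ?enorm_ge0.
Qed.

(** Each of the four faces has area at most [r ^+ 2 / 2]; the determinant being
   nonzero, the denominator of the kernel is positive. *)
Lemma menger_kernel_ge (x0 x1 x2 x3 : 'rV[R]_3) (r D : R) :
  let T := [tuple x0; x1; x2; x3] in
  0 < D -> D <= `|det3 (x1 - x0) (x2 - x0) (x3 - x0)| ->
  (forall i j, enorm (tnth T i - tnth T j) <= r) ->
  D / (12 * r ^+ 4) <= menger_kernel T.
Proof.
move=> T D0 hD hr.
have det0 : det3 (x1 - x0) (x2 - x0) (x3 - x0) != 0.
  by rewrite -normr_gt0 (lt_le_trans D0).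
have x10 : 0 < enorm (x1 - x0).
  rewrite enorm_gt0; apply: contraNneq det0 => ->.
  by rewrite det3E !mxE; apply/eqP; ring.
have r0 : 0 < r.
  by apply: lt_le_trans x10 _; have := hr 1 0; rewrite !(tnth_nth 0).
have diamT : ediam [set x | x \in T] \is a fin_num /\
    0 < tetra_diam T <= r.
  have hub : (ediam [set x | x \in T] <= r%:E)%E.
    rewrite /ediam ge_max lee_fin ltW//=; apply: ge_ereal_sup => _ [[y z] [/= Ty Tz] <-].
    by move: Ty Tz => /tnthP[i ->] /tnthP[j ->]; rewrite lee_fin hr.
  have hlb : ((enorm (x1 - x0))%:E <= ediam [set x | x \in T])%E.
    by apply: enorm_le_ediam; rewrite /= !inE eqxx ?orbT.
  have hf : ediam [set x | x \in T] \is a fin_num.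
    by rewrite ge0_fin_numE ?ediam_ge0// (le_lt_trans hub)// ltry.
  split=> //; rewrite -lee_fin -lte_fin fineK// hub andbT.
  by rewrite (lt_le_trans _ hlb)// lte_fin.
case: diamT => _ /andP[diam0 diamr].
have ncop : coplanar T = false.
  rewrite /coplanar mxrank_unit// unitmxE det_edge_matrix unitfE//.
have area0 : 0 < tetra_area T.
  rewrite /tetra_area big_ord_recr/= ltr_wpDl//.
    by apply: sumr_ge0 => i _; exact: triangle_area_ge0.
  rewrite !(tnth_nth 0)/= triangle_areaE divr_gt0// enorm_gt0.
  apply: contraNneq det0 => c0.
  by rewrite /det3 c0 dot0l.
have areale : tetra_area T <= 2 * r ^+ 2.
  rewrite (_ : 2 * r ^+ 2 = \sum_(i < 4) (r ^+ 2 / 2)); last first.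
    by rewrite sumr_const card_ord -mulr_natr; field.
  by apply: ler_sum => i _; apply: triangle_area_le; exact: hr.
rewrite /menger_kernel ncop /tetra_volume det_edge_matrix.
have dd0 : 0 < tetra_diam T ^+ 2 by rewrite exprn_gt0.
have ddr : tetra_diam T ^+ 2 <= r ^+ 2 by rewrite ler_sqr ?nnegrE// ltW.
apply: (@le_trans _ _ (D / 6 / (2 * r ^+ 2 * r ^+ 2))).
  rewrite le_eqVlt; apply/orP; left; apply/eqP; field.
  by rewrite gt_eqF.
apply: ler_pM.
- by rewrite divr_ge0// ltW.
- by have r20 := sqr_ge0 r; rewrite invr_ge0 mulr_ge0// mulr_ge0.
- by rewrite ler_pM2r ?invr_gt0.
- rewrite lef_pV2 ?posrE ?mulr_gt0 ?exprn_gt0//.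
  by rewrite ler_pM// ltW.
Qed.

End menger_kernel_lower_bound.

Section small_volumes.
Variable R : realType.
Implicit Types (x y z : 'rV[R]_3).

(** The determinant of the edges at a vertex is six times the volume. *)
Definition thin_tetrahedra (S : set 'rV[R]_3) (eta rho : R) : Prop :=
  forall y0 y1 y2 y3, S y0 -> S y1 -> S y2 -> S y3 ->
    `|det3 (y1 - y0) (y2 - y0) (y3 - y0)| <= eta * rho ^+ 3.

(** If one tetrahedron is thick, then so are all those with vertices in balls of
   radius [t = eta / 112 * rho] about its vertices; the measures of these balls
   bound the energy from below. By [det3_perturb] the determinants change by at
   most [7 * (2 * rho) ^+ 2 * (2 * t)], which is half of [eta * rho ^+ 3]; and
   [menger_kernel_ge] for vertices at distance at most [4 * rho] gives the
   factor [24 * 4 ^+ 4]. *)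
Lemma energy_thin (p c eta rho E : R) (S : set 'rV[R]_3) x :
  0 < p -> 0 < c -> 0 < eta -> eta <= 1 -> 0 < rho -> closed S ->
  (forall y, S y ->
     ((c * (eta / 112 * rho) ^+ 2)%:E <= hausdorff2 (S `&` eball y (eta / 112 * rho)))%E) ->
  (menger_energy p S < E%:E)%E ->
  E <= (eta / (24 * 4 ^+ 4) / rho) `^ p * (c * (eta / 112 * rho) ^+ 2) ^+ 4 ->
  thin_tetrahedra (S `&` eball x rho) eta rho.
Proof.
move=> p0 c0 e0 e1 rho0 cS ahl hE Ele y0 y1 y2 y3 [S0 b0] [S1 b1] [S2 b2] [S3 b3].
rewrite leNgt; apply/negP => thick.
move: hE; apply/negP; rewrite -leNgt.
have [t tE] : exists t, t = eta / 112 * rho by eexists.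
rewrite -tE in ahl Ele.
have t0 : 0 < t by rewrite tE !mulr_gt0.
have tr : t <= rho by rewrite tE; nra.
set m := c * t ^+ 2; set a := (eta / (24 * 4 ^+ 4) / rho) `^ p.
have m0 : 0 <= m by rewrite /m mulr_ge0 ?sqr_ge0// ltW.
have a0 : 0 <= a by exact: powR_ge0.
have kge z0 z1 z2 z3 : (S `&` eball y0 t) z0 -> (S `&` eball y1 t) z1 ->
    (S `&` eball y2 t) z2 -> (S `&` eball y3 t) z3 ->
    a <= menger_kernel [tuple z0; z1; z2; z3] `^ p.
  move=> [_ h0] [_ h1] [_ h2] [_ h3].
  have gen (u v : R) : 0 <= u -> u <= v -> u `^ p <= v `^ p.
    by move=> u0 uv; apply: (ge0_ler_powR (ltW p0)); rewrite ?nnegrE// (le_trans u0).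
  apply: gen; first by rewrite !divr_ge0 ?mulr_ge0 ?exprn_ge0 ?(ltW e0) ?(ltW rho0).
  rewrite (_ : eta / (24 * 4 ^+ 4) / rho = (eta * rho ^+ 3 / 2) / (12 * (4 * rho) ^+ 4)); last first.
    by field; rewrite gt_eqF.
  have e30 : 0 < eta * rho ^+ 3 by rewrite mulr_gt0// exprn_gt0.
  apply: menger_kernel_ge; first by rewrite divr_gt0.
    have dd (u v u' v' : 'rV[R]_3) : u' - v' = (u - v) + ((u' - u) - (v' - v)).
      by apply/rowP => i; rewrite !mxE; ring.
    rewrite (dd y1 y0 z1) (dd y2 y0 z2) (dd y3 y0 z3).
    have sm (u v u' v' : 'rV[R]_3) :
        eball u t u' -> eball v t v' -> enorm ((u' - u) - (v' - v)) <= 2 * t.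
      by rewrite /eball/= => hu hv; apply: le_trans (enormB _ _) _; lra.
    have bg (u v : 'rV[R]_3) : eball x rho u -> eball x rho v -> enorm (u - v) <= 2 * rho.
      rewrite /eball/= => hu hv; apply: le_trans (enorm_dist3 u x v) _.
      by rewrite (enormBC x); lra.
    have t2 : 0 <= 2 * t <= 2 * rho by apply/andP; split; lra.
    have := det3_perturb t2 (bg _ _ b1 b0) (bg _ _ b2 b0) (bg _ _ b3 b0)
      (sm _ _ _ _ h1 h0) (sm _ _ _ _ h2 h0) (sm _ _ _ _ h3 h0).
    rewrite (_ : 7 * (2 * rho) ^+ 2 * (2 * t) = eta * rho ^+ 3 / 2); last first.
      by rewrite tE; field.
    move: thick; set d := det3 _ _ _; set d' := det3 _ _ _ => thick dd'.
    by have := lerB_dist d d'; rewrite -(distrC d') => q; lra.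
  have near (u u' : 'rV[R]_3) : eball x rho u -> eball u t u' -> enorm (u' - x) <= 2 * rho.
    by rewrite /eball/= => hu hv; apply: le_trans (enorm_dist3 u' u x) _; lra.
  have {}near i : enorm (tnth [tuple z0; z1; z2; z3] i - x) <= 2 * rho.
    rewrite (tnth_nth 0); case: i => [[|[|[|[|//]]]] hi] /=.
    - exact: near b0 h0.
    - exact: near b1 h1.
    - exact: near b2 h2.
    - exact: near b3 h3.
  move=> i j; apply: le_trans (enorm_dist3 _ x _) _.
  by rewrite (enormBC x); have := near i; have := near j; lra.
have cb y : closed (S `&` eball y t) by apply: closedI => //; exact: eball_closed.
have sb y : S `&` eball y t `<=` S by move=> ? [].
have amm n : 0 <= a * m ^+ n by rewrite mulr_ge0// exprn_ge0.
have pos (u : R) : (0 <= (u `^ p)%:E)%E by rewrite lee_fin powR_ge0.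
rewrite /menger_energy (le_trans (y := (a * m ^+ 4)%:E))//.
rewrite exprSr mulrA; apply: (integral_ge_cst (cb y3)) => //; first exact: ahl.
  move=> z3; do 3 (apply: integral_ge0 => ? _); exact: pos.
move=> z3 h3.
rewrite exprSr mulrA; apply: (integral_ge_cst (cb y2)) => //; first exact: ahl.
  move=> z2; do 2 (apply: integral_ge0 => ? _); exact: pos.
move=> z2 h2.
rewrite exprSr mulrA; apply: (integral_ge_cst (cb y1)) => //; first exact: ahl.
  move=> z1; apply: integral_ge0 => ? _; exact: pos.
move=> z1 h1.
rewrite expr1; apply: (integral_ge_cst (cb y0)) => //; first exact: ahl.
by move=> z0 h0; rewrite lee_fin; exact: kge.
Qed.

End small_volumes.
(** * Two-sided flatness *)

Section crossing.
Variable R : realType.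
Implicit Types (U : set 'rV[R]_3) (x y z n m e : 'rV[R]_3).

Lemma boundary_notin U y : open U -> boundary U y -> ~ U y.
Proof. by move=> oU [_ nU] Uy; apply: nU; move: oU; rewrite openE; apply. Qed.

Lemma closure_notin_boundary U y : open U -> closure U y -> ~ boundary U y -> U y.
Proof.
move=> oU cy nb; apply: contrapT => nUy; apply: nb; split=> // iU.
by apply: nUy; exact: interior_subset iU.
Qed.

(** On a segment that avoids the boundary, [U] and its closure have the same
   trace, which is therefore open and closed in a connected set. *)
Lemma segment_inside U y z : open U ->
  (forall t : R, 0 <= t <= 1 -> ~ boundary U (y + t *: (z - y))) -> U y -> U z.
Proof.
move=> oU nb Uy.
pose f (t : R) := y + t *: (z - y).
have cf : continuous f.
  by move=> t; apply: cvgD; [exact: cvg_cst|exact: scalel_continuous].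
have cI : connected (f @` [set` `[0, 1]]).
  apply: connected_continuous_connected; first exact: segment_connected.
  exact: continuous_subspaceT.
have inS t : 0 <= t <= 1 -> [set` `[0, 1]] t by move=> ?; rewrite /= in_itv.
have f0 : f 0 = y by rewrite /f scale0r addr0.
have f1 : f 1 = z by rewrite /f scale1r addrC subrK.
have AE : f @` [set` `[0, 1]] `&` U = f @` [set` `[0, 1]].
  apply: cI.
  - by exists y; split=> //; exists 0 => //; apply: inS; rewrite lexx ler01.
  - by exists U.
  - exists (closure U); first exact: closed_closure.
    apply/seteqP; split=> w [Aw]; first by split=> //; exact: subset_closure.
    move=> cw; split=> //; case: Aw cw => t /=; rewrite in_itv/= => t01 <- cw.
    exact: closure_notin_boundary (nb _ t01).
have : (f @` [set` `[0, 1]]) z by exists 1 => //; apply: inS; rewrite lexx ler01.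
by rewrite -AE => -[].
Qed.

Lemma segment_outside U y z : open U ->
  (forall t : R, 0 <= t <= 1 -> ~ boundary U (y + t *: (z - y))) ->
  ~ closure U y -> ~ closure U z.
Proof.
move=> oU nb ncy cz; apply: ncy; apply: subset_closure.
have nbz : ~ boundary U z.
  by have := nb 1; rewrite scale1r addrC subrK; apply; rewrite ler01 lexx.
have Uz := closure_notin_boundary oU cz nbz.
apply: (segment_inside oU _ Uz) => t /andP[t0 t1].
rewrite (_ : z + t *: (y - z) = y + (1 - t) *: (z - y)); last first.
  by apply/rowP => i; rewrite !mxE; ring.
by apply: nb; apply/andP; split; lra.
Qed.

Lemma segment_crossing U y z : open U -> U y -> ~ closure U z ->
  exists2 t : R, 0 <= t <= 1 & boundary U (y + t *: (z - y)).
Proof.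
move=> oU Uy ncz; apply: contrapT => nex; apply: ncz; apply: subset_closure.
apply: (segment_inside oU _ Uy) => t t01 bt; apply: nex; by exists t.
Qed.

(** A bilateral notion: the boundary misses both caps, hence lies in a slab; and
   as the caps belong to different sides of it, every segment across the slab
   meets it. Since [n] points into [U], normals are compared without a choice
   of signs. *)
Definition flat U x (rho : R) n (eps : R) : Prop :=
  enorm n = 1 /\ forall y, eball x rho y ->
    (eps * rho < dot (y - x) n -> U y) /\
    (dot (y - x) n < - (eps * rho) -> ~ closure U y).

Lemma flat_slab U x rho n eps y : open U -> flat U x rho n eps ->
  boundary U y -> eball x rho y -> `|dot (y - x) n| <= eps * rho.
Proof.
move=> oU [_ fl] by_ xy; have [f1 f2] := fl _ xy.
rewrite ler_norml; apply/andP; split; rewrite leNgt; apply/negP.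
  by move=> /f2; apply; case: by_.
by move=> /f1; exact: boundary_notin.
Qed.

Lemma flat_crossing U x rho n eps e : open U -> flat U x rho n eps ->
  0 < rho -> eps <= 2^-1 -> dot e n = 0 -> enorm e <= rho / 2 ->
  exists2 s : R, `|s| <= eps * rho & boundary U (x + e + s *: n).
Proof.
move=> oU fl r0 eps2 en er; have [n1 fl'] := fl.
have nn : dot n n = 1 by rewrite enormK n1 expr1n.
have ee : dot e e <= (rho / 2) ^+ 2 by rewrite -enorm_le_sqr// divr_ge0// ltW.
pose h := 3 / 4 * rho.
(* The height [3 / 4 * rho] lies above the slab, and within the ball because the
   base point is at distance at most [rho / 2]. *)
have inb s : `|s| <= h -> eball x rho (x + e + s *: n).
  move=> sh; rewrite /eball/= enorm_le_sqr; last exact: ltW.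
  rewrite -(addrA x) addrKl !dot_linear (dotC n) en nn.
  have ss : s * s <= h * h.
    by rewrite -!expr2 -(real_normK (num_real s)) ler_sqr ?nnegrE ?mulr_ge0// ltW.
  rewrite /h in ss; nra.
have dots s : dot (x + e + s *: n - x) n = s.
  by rewrite -(addrA x) addrKl !dot_linear en nn; ring.
have h0 : 0 < h by rewrite /h; lra.
have eh : eps * rho < h by rewrite /h; nra.
have hh : `|h| <= h by rewrite ger0_norm// ltW.
have hN : `|- h| <= h by rewrite normrN.
have Uh : U (x + e + h *: n) by apply: (fl' _ (inb _ hh)).1; rewrite dots.
have Un : ~ closure U (x + e + - h *: n).
  by apply: (fl' _ (inb _ hN)).2; rewrite dots ltrN2.
have [t /andP[t0 t1] bt] := segment_crossing oU Uh Un.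
have E : x + e + h *: n + t *: (x + e + - h *: n - (x + e + h *: n)) =
    x + e + (h * (1 - 2 * t)) *: n.
  by apply/rowP => i; rewrite !mxE; ring.
rewrite E in bt; exists (h * (1 - 2 * t)) => //.
rewrite -[X in `|X|]dots; apply: (flat_slab oU fl bt); apply: inb.
by rewrite normrM ger0_norm ?(ltW h0)// ler_piMr ?(ltW h0)// ler_norml; apply/andP; split; lra.
Qed.

(** Just enough information around [x] to determine a plane: two boundary
   points over orthogonal directions, and the sides of the domain. *)
Definition triad U x (rho : R) n : Prop :=
  exists e1 e2 (s t : R), [/\ frame e1 e2 n, `|s| <= 1 /\ `|t| <= 1,
    boundary U (x + rho *: (e1 + s *: n)),
    boundary U (x + rho *: (e2 + t *: n)) &
    U (x + rho *: n) /\ ~ closure U (x - rho *: n)].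

Lemma flat_triad U x rho n eps : open U -> 0 < rho -> eps < 2^-1 ->
  flat U x (2 * rho) n eps -> triad U x rho n.
Proof.
move=> oU r0 e2' fl; have [n1 fl'] := fl.
have [e1 [e2 fr]] := frame_exists n1.
have [[ee1 ee2 nn] [e12 e1n e2n] _] := fr.
have side e : dot e e = 1 -> dot e n = 0 ->
    exists2 s : R, `|s| <= 1 & boundary U (x + rho *: (e + s *: n)).
  move=> ee en; have [||||s hs bs] := @flat_crossing U x _ n eps (rho *: e) oU fl.
  - by lra.
  - exact: ltW.
  - by rewrite !dot_linear en mulr0.
  - rewrite enorm_le_sqr; last by lra.
    by rewrite !dot_linear ee; lra.
  exists (s / rho).
    rewrite normrM normfV (ger0_norm (ltW r0)) ler_pdivrMr// mul1r.
    by apply: le_trans hs _; nra.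
  rewrite (_ : rho *: (e + _) = rho *: e + s *: n) ?addrA//.
  by rewrite scalerDr scalerA mulrC divfK// gt_eqF.
have [s s1 bs] := side _ ee1 e1n; have [t t1 bt] := side _ ee2 e2n.
exists e1, e2, s, t; split; [exact: fr|by []|exact: bs|exact: bt|].
have nr : enorm (rho *: n) = rho by rewrite enormZ n1 mulr1 ger0_norm// ltW.
split.
  have [|f1 _] := fl' (x + rho *: n); first by rewrite /eball/= addrKl nr; lra.
  by apply: f1; rewrite addrKl !dot_linear nn; nra.
have [|_ f2] := fl' (x - rho *: n); first by rewrite /eball/= addrKl enormN nr; lra.
by apply: f2; rewrite addrKl !dot_linear nn; nra.
Qed.

(** The cone with aperture [pi / 4] contains the points over [rho *: e] at height
   [rho], for every unit vector [e] orthogonal to its axis. *)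
Lemma cone_triad U x v (delta rho : R) : open U -> enorm v = 1 ->
  eball x delta `&` translate x (cone_pos (pi / 4) v) `<=` U `|` [set x] ->
  eball x delta `&` translate x (cone_neg (pi / 4) v) `<=` ~` closure U `|` [set x] ->
  0 < rho -> 2 * rho <= delta -> triad U x rho v.
Proof.
move=> oU v1 Cp Cn r0 rd.
have [e1 [e2 fr]] := frame_exists v1.
have [[ee1 ee2 nn] [e12 e1n e2n] _] := fr.
have c2 : cos (pi / 4 : R) ^+ 2 = 2^-1.
  have := cos_mulr2n (pi / 4 : R); rewrite (_ : pi / 4 *+ 2 = pi / 2); last first.
    by rewrite -mulr_natr; move: (pi : R) => q; field.
  by rewrite cos_pihalf -mulr_natr; lra.
have inC w : 0 < dot w v -> dot w w <= 2 * dot w v ^+ 2 ->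
    dot w w <= (2 * rho) ^+ 2 ->
    U (x + w) /\ ~ closure U (x - w).
  move=> wv ww wr.
  have wd : enorm w <= delta.
    by apply: le_trans rd; rewrite enorm_le_sqr// mulr_ge0// ltW.
  have w0 : w != 0 by apply: contraTneq wv => ->; rewrite dot0l ltxx.
  have wc : enorm w * cos (pi / 4) <= dot w v.
    apply: le_trans (ler_norm _) _.
    rewrite -[leRHS]ger0_norm ?(ltW wv)// -ler_sqr ?nnegrE// !real_normK ?num_real//.
    by rewrite exprMn -enormK c2; lra.
  split.
    have [|//|/= xw] := Cp (x + w).
      split; first by rewrite /eball/= addrKl.
      by exists w.
    by move: xw => /eqP; rewrite -[X in _ == X]addr0 (inj_eq (addrI x)) (negbTE w0).
  have [|//|/= xw] := Cn (x - w).
    split; first by rewrite /eball/= addrKl enormN.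
    by exists (- w) => //; rewrite /cone_neg/= enormN dotNl opprK.
  move: xw => /eqP; rewrite -[X in _ == X]addr0 (inj_eq (addrI x)).
  by rewrite oppr_eq0 (negbTE w0).
have side e : dot e e = 1 -> dot e v = 0 ->
    exists2 s : R, `|s| <= 1 & boundary U (x + rho *: (e + s *: v)).
  move=> ee ev.
  have ve : dot v e = 0 by rewrite dotC.
  have [|||U1 _] := inC (rho *: (e + v)); rewrite ?dot_linear ?ee ?ev ?ve ?nn; try by nra.
  have [|||_ U2] := inC (rho *: (v - e)); rewrite ?dot_linear ?ee ?ev ?ve ?nn; try by nra.
  have [t /andP[t0 t1]] := segment_crossing oU U1 U2.
  rewrite (_ : x + _ + _ = x + rho *: (e + (1 - 2 * t) *: v)); last first.
    by apply/rowP => i; rewrite !mxE; ring.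
  by exists (1 - 2 * t) => //; rewrite ler_norml; apply/andP; split; lra.
have [s s1 bs] := side _ ee1 e1n; have [t t1 bt] := side _ ee2 e2n.
exists e1, e2, s, t; split; [exact: fr|by []|exact: bs|exact: bt|].
by apply: inC; rewrite ?dot_linear ?nn; nra.
Qed.

(** The plane through [x] and the two boundary points of a triad: it contains
   the boundary up to a small height because the tetrahedra are thin; and each
   of the two remaining convex caps contains no boundary point, so it lies on
   the same side as the point [x + rho *: n] or [x - rho *: n] in it. *)
Lemma triad_flat U x rho n eta : open U -> boundary U x -> 0 < rho ->
  0 < eta -> 128 * eta < 1 -> triad U x rho n ->
  thin_tetrahedra (boundary U `&` eball x (4 * rho)) eta (4 * rho) ->
  exists m, flat U x (4 * rho) m (16 * eta).
Proof.
move=> oU bx r0 e0 e128 [e1 [e2 [s [t [fr [s1 t1] b1 b2 [Un nUn]]]]]] thin.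
have [[ee1 ee2 nn] [e12 e1n e2n] d1] := fr.
have ne1 : dot n e1 = 0 by rewrite dotC.
have ne2 : dot n e2 = 0 by rewrite dotC.
have e21 : dot e2 e1 = 0 by rewrite dotC.
have ss : s * s <= 1.
  by rewrite -expr2 -(real_normK (num_real s)) expr_le1.
have tt : t * t <= 1.
  by rewrite -expr2 -(real_normK (num_real t)) expr_le1.
set u := e1 + s *: n in b1; set v := e2 + t *: n in b2.
(* The normal [c] of the new plane has squared norm [1 + s ^+ 2 + t ^+ 2], so it
   is at most twice as long as its component along [n]. *)
set c := cross u v.
have cc : dot c c = 1 + s * s + t * t.
  rewrite lagrange_identity !dot_linear ee1 ee2 nn e12 e1n e2n ne1 ne2; ring.
have cn : dot c n = 1.
  have -> : dot c n = det3 e1 e2 n by rewrite /c /u /v -/(det3 _ _ _) !det3E !mxE; ring.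
  exact: d1.
set L := enorm c.
have LL : L * L = 1 + s * s + t * t by rewrite -expr2 -enormK cc.
have L0 : 0 <= L by exact: enorm_ge0.
have L1 : 1 <= L by nra.
have L2 : L <= 2 by nra.
have Lp : 0 < L by lra.
pose m := L^-1 *: c.
have m1 : enorm m = 1 by rewrite enormZ ger0_norm ?invr_ge0// mulVf// gt_eqF.
have mn : dot n m = L^-1 by rewrite dotZr dotC cn mulr1.
have Li : 2^-1 <= L^-1 <= 1.
  by apply/andP; split; [rewrite lef_pV2 ?posrE|rewrite invf_le1].
have inb w : dot w w <= 4 -> eball x (4 * rho) (x + rho *: w).
  move=> ww; rewrite /eball/= addrKl enorm_le_sqr; last by lra.
  by rewrite !dot_linear; nra.
set h := 16 * eta * (4 * rho).
have slab y : boundary U y -> eball x (4 * rho) y -> `|dot (y - x) m| <= h.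
  move=> by_ xy.
  have x4 : eball x (4 * rho) x by apply: eball_center; lra.
  have := thin x (x + rho *: u) (x + rho *: v) y (conj bx x4).
  move/(_ (conj b1 (inb _ _)))/(_ (conj b2 (inb _ _)))/(_ (conj by_ xy)).
  rewrite !(addrC x) !addrK.
  have -> : det3 (rho *: u) (rho *: v) (y - x) = rho ^+ 2 * dot (y - x) c.
    by rewrite dotC -/(det3 _ _ _) !det3E !mxE; ring.
  rewrite normrM (ger0_norm (sqr_ge0 rho)).
  rewrite (_ : eta * (4 * rho) ^+ 3 = rho ^+ 2 * h); last by rewrite /h; ring.
  rewrite ler_pM2l ?exprn_gt0// => H.
  rewrite dotZr normrM ger0_norm ?invr_ge0//; apply: le_trans (H _ _).
  - by case/andP: Li => _ Li; rewrite ler_piMl.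
  - by rewrite !dot_linear ee1 nn e1n ne1; lra.
  - by rewrite !dot_linear ee2 nn e2n ne2; lra.
have hr : h < rho / 2 by rewrite /h; nra.
have h0 : 0 < h by rewrite /h !mulr_gt0.
(* Both caps are treated at once: [q] is the sign of the cap. *)
have seg y w (q : R) : `|q| = 1 -> eball x (4 * rho) y -> eball x (4 * rho) w ->
    h < q * dot (y - x) m -> h < q * dot (w - x) m ->
    forall t : R, 0 <= t <= 1 -> ~ boundary U (w + t *: (y - w)).
  move=> q1 xy xw hy hw k /andP[k0 k1] bk.
  have E : w + k *: (y - w) - x = (1 - k) *: (w - x) + k *: (y - x).
    by apply/rowP => i; rewrite !mxE; ring.
  have : `|dot (w + k *: (y - w) - x) m| <= h.
    apply: slab => //; rewrite /eball/= E.
    apply: le_trans (enormD _ _) _; rewrite !enormZ !ger0_norm//; last by lra.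
    rewrite (_ : 4 * rho = (1 - k) * (4 * rho) + k * (4 * rho)); last by ring.
    by rewrite lerD// ler_wpM2l//; lra.
  rewrite -[leLHS]mul1r -q1 -normrM => /(le_trans (ler_norm _)).
  rewrite E dotDl !dotZl mulrDr (mulrCA q) (mulrCA q) => H.
  have k2 : 0 <= 1 - k by lra.
  have := ler_wpM2l k2 (ltW hw); have := ler_wpM2l k0 (ltW hy).
  move: hy hw H; set a := q * _; set b := q * _ => hy hw H.
  by nra.
have n4 : dot n n <= 4 by rewrite nn; lra.
have bn := inb _ n4.
have bn' : eball x (4 * rho) (x - rho *: n).
  by rewrite -scalerN; apply: inb; rewrite dotNl dotNr opprK.
case/andP: Li => Li _.
have dn : h < dot (x + rho *: n - x) m by rewrite addrKl dotZl mn; nra.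
exists m; split=> // y xy; split=> [hy|hy].
  apply: (segment_inside oU _ Un); apply: (seg _ _ 1) => //; rewrite ?normr1 ?mul1r//.
apply: (segment_outside oU _ nUn); apply: (seg _ _ (-1)) => //.
- by rewrite normrN1.
- by rewrite mulN1r ltrNr.
- by rewrite mulN1r addrKl dotNl opprK dotZl mn; nra.
Qed.

(** The boundary point [x] is itself within the slab around [y]; a factor two
   comes from this, another one from halving the scale. *)
Lemma flat_recentre U x y rho m eps : open U -> boundary U x ->
  flat U y (2 * rho) m eps -> enorm (x - y) <= rho ->
  flat U x rho m (4 * eps).
Proof.
move=> oU bx fl xy; have [m1 fl'] := fl; split=> // z; rewrite /eball/= => zx.
have r0 : 0 <= rho by rewrite (le_trans _ xy)// enorm_ge0.
have zy : eball y (2 * rho) z.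
  by rewrite /eball/=; apply: le_trans (enorm_dist3 z x y) _; lra.
have yx : eball y (2 * rho) x by rewrite /eball/=; lra.
have := flat_slab oU fl bx yx; rewrite ler_norml => /andP[sl1 sl2].
have [f1 f2] := fl' _ zy.
have dE : dot (z - y) m = dot (z - x) m + dot (x - y) m.
  by rewrite -dotDl addrA subrK.
by split=> h; [apply: f1|apply: f2]; lra.
Qed.

(** The boundary has a point over [rho / 2] times the direction of the component
   [w] of [m] orthogonal to [n]; its height over the plane of [m] is about
   [rho / 2 * enorm w]. *)
Lemma flat_tilt U x rho n m eps h : open U -> 0 < rho -> eps <= 2^-1 ->
  flat U x rho n eps -> enorm m = 1 ->
  (forall y, boundary U y -> eball x rho y -> `|dot (y - x) m| <= h * rho) ->
  enorm (m - dot m n *: n) <= 2 * (eps + h).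
Proof.
move=> oU r0 e2 fl m1 slab; have [n1 _] := fl.
have nn : dot n n = 1 by rewrite enormK n1 expr1n.
have [w wE] : exists w, w = m - dot m n *: n by eexists.
rewrite -wE; have wn : dot w n = 0 by rewrite wE !dot_linear nn; ring.
have wm : dot w m = dot w w.
  have mE : m = w + dot m n *: n by rewrite wE subrK.
  by rewrite [X in dot w X = _]mE dotDr dotZr wn mulr0 addr0.
have [w0|w0] := eqVneq w 0.
  have [s hs bs] : exists2 s : R, `|s| <= eps * rho & boundary U (x + 0 + s *: n).
    apply: (flat_crossing oU fl) => //; first by rewrite dot0l.
    by rewrite enorm0 divr_ge0// ltW.
  have e0 : 0 <= eps by rewrite -(pmulr_lge0 _ r0) (le_trans _ hs).
  have h0 : 0 <= h.
    rewrite -(pmulr_lge0 _ r0); apply: le_trans (slab _ bs _) => //.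
    rewrite /eball/= addr0 addrKl enormZ n1 mulr1 (le_trans hs)//.
    by nra.
  by rewrite w0 enorm0; lra.
have W0 : 0 < enorm w by rewrite enorm_gt0.
set W := enorm w in W0 *.
have ww : dot w w = W * W by rewrite enormK expr2.
have [||s hs bs] := @flat_crossing U x rho n eps ((rho / (2 * W)) *: w) oU fl r0 e2.
- by rewrite dotZl wn mulr0.
- rewrite enormZ ger0_norm ?divr_ge0 ?mulr_ge0 ?(ltW r0) ?(ltW W0)//.
  by rewrite -/W le_eqVlt; apply/orP; left; apply/eqP; field; rewrite gt_eqF.
have mn : `|dot n m| <= 1 by rewrite (le_trans (dot_le _ _))// n1 m1 mulr1.
have := slab _ bs.
rewrite -(addrA x) addrKl dotDl !dotZl wm ww.
have -> : rho / (2 * W) * (W * W) = rho * W / 2 by field; rewrite gt_eqF.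
move=> H; have {}H : `|rho * W / 2 + s * dot n m| <= h * rho.
  apply: H; rewrite /eball/= addrKl enorm_le_sqr; last exact: ltW.
  rewrite !dot_linear wn (dotC n w) wn nn ww.
  rewrite [leLHS](_ : _ = rho ^+ 2 / 4 + s * s); last by field; rewrite gt_eqF.
  have s2 : s * s <= (rho / 2) ^+ 2.
    rewrite -expr2 -(real_normK (num_real s)) ler_sqr ?nnegrE ?divr_ge0 ?(ltW r0)//.
    by rewrite (le_trans hs)//; nra.
  by nra.
have sd : `|s * dot n m| <= eps * rho.
  by rewrite normrM (le_trans _ hs)// ler_piMr.
move: H sd; rewrite !ler_norml => /andP[_ H1] /andP[H2 _].
by rewrite -(ler_pM2l r0); lra.
Qed.

(** By [flat_tilt] the vector [m] is close to [n] or to [- n]; the second case is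
   excluded by the point [x + (rho / 2) *: n], which is in [U]. *)
Lemma flat_compare U x rho n m eps eps' : open U -> 0 < rho ->
  eps <= 8^-1 -> eps' <= 8^-1 -> flat U x rho n eps -> flat U x rho m eps' ->
  enorm (m - n) <= 4 * (eps + eps').
Proof.
move=> oU r0 e8 e8' fl fl'.
have e2 : eps <= 2^-1 by lra.
have [n1 fn] := fl; have [m1 fm] := fl'.
have nn : dot n n = 1 by rewrite enormK n1 expr1n.
have mm : dot m m = 1 by rewrite enormK m1 expr1n.
have wle := flat_tilt oU r0 e2 fl m1 (fun y by_ xy => flat_slab oU fl' by_ xy).
set d := dot m n in wle; set w := m - d *: n in wle.
have wdw : dot w w = 1 - d ^+ 2 by rewrite /w !dot_linear mm nn (dotC n) -/d; ring.
rewrite enormK in wdw.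
set W := enorm w in wle wdw; have W0 : 0 <= W by exact: enorm_ge0.
have d_pos : - (1 / 4) <= d.
  rewrite leNgt; apply/negP => dneg.
  have pn : eball x rho (x + (rho / 2) *: n).
    by rewrite /eball/= addrKl enormZ n1 mulr1 ger0_norm; lra.
  have [U1 _] := fn _ pn; have [_ U2] := fm _ pn.
  apply: U2; last apply: subset_closure; last apply: U1.
    by rewrite addrKl dotZl (dotC n) -/d; nra.
  by rewrite addrKl dotZl nn; nra.
have W2 : W <= 2^-1 by lra.
have d0 : 0 <= d by nra.
have d1 : d <= 1 by nra.
have -> : m - n = w + (d - 1) *: n by apply/rowP => i; rewrite !mxE; ring.
apply: le_trans (enormD _ _) _; rewrite enormZ n1 mulr1 -normrN ger0_norm; last by lra.
by rewrite -/W; nra.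
Qed.

(** By [flat_crossing] the boundary projects onto a square of side [rho / 2] in the
   plane orthogonal to [n]. *)
Lemma flat_ahlfors U x rho n eps : open U -> 0 < rho -> eps <= 2^-1 ->
  flat U x rho n eps ->
  ((rho ^+ 2 / 32)%:E <= hausdorff2 (boundary U `&` eball x rho))%E.
Proof.
move=> oU r0 e2 fl; have [n1 _] := fl.
have [f1 [f2 [[ee1 ee2 nn] [e12 e1n e2n] _]]] := frame_exists n1.
have n_1 : enorm f1 = 1 by rewrite /enorm ee1 sqrtr1.
have n_2 : enorm f2 = 1 by rewrite /enorm ee2 sqrtr1.
have e21 : dot f2 f1 = 0 by rewrite dotC.
have ne1 : dot n f1 = 0 by rewrite dotC.
have ne2 : dot n f2 = 0 by rewrite dotC.
have r4 : 0 < rho / 4 by lra.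
apply: le_trans (@hausdorff2_ge_square _ _ x f1 f2 _ r4 n_1 n_2 _).
  rewrite lee_fin; have := pi_ge2 R; move: (pi : R) => q q2; nra.
move=> s t hs ht.
have sq (a b : R) : `|a| <= b -> a * a <= b * b.
  move=> ab; have b0 : 0 <= b by rewrite (le_trans _ ab).
  by rewrite -!expr2 -(real_normK (num_real a)) ler_sqr ?nnegrE.
have := sq _ _ hs; have := sq _ _ ht => tt ss.
have [||k hk bk] := @flat_crossing U x rho n eps (s *: f1 + t *: f2) oU fl r0 e2.
- by rewrite !dot_linear e1n e2n; ring.
- rewrite enorm_le_sqr; last by lra.
  by rewrite !dot_linear ee1 ee2 e12 e21; nra.
have hk2 : `|k| <= rho / 2 by rewrite (le_trans hk)//; nra.
have kk := sq _ _ hk2.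
exists (x + (s *: f1 + t *: f2) + k *: n).
have E : x + (s *: f1 + t *: f2) + k *: n - x = s *: f1 + t *: f2 + k *: n.
  by rewrite -(addrA x) addrKl.
split; rewrite ?E.
- split=> //; rewrite /eball/= E enorm_le_sqr ?(ltW r0)//.
  by rewrite !dot_linear ee1 ee2 e12 e21 e1n e2n ne1 ne2 nn; nra.
- by rewrite !dot_linear ee1 e21 ne1; ring.
- by rewrite !dot_linear ee2 e12 ne2; ring.
Qed.

End crossing.
(** * Flatness at all scales below a uniform one *)

Section scales.
Variable R : realType.
Implicit Types (U S : set 'rV[R]_3) (x y z n m : 'rV[R]_3) (p E c e kappa eta rho : R).

(** Doubling the scale leads from [a] to any scale in finitely many steps. *)
Lemma dyadic_induction (P : R -> Prop) (a b : R) : 0 < a ->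
  (forall r, 0 < r <= a -> r <= b -> P r) ->
  (forall r, 0 < r <= b -> (forall s, 0 < s <= r / 2 -> P s) -> P r) ->
  forall r, 0 < r <= b -> P r.
Proof.
move=> a0 Pa Pstep.
have H (k : nat) : forall r, 0 < r <= b -> r <= 2 ^+ k * a -> P r.
  elim: k => [|k IH] r rb; first by rewrite mul1r => ra; case/andP: rb => r0 rb; apply: Pa; rewrite ?r0.
  move=> ra; apply: Pstep => // s /andP[s0 sr]; apply: IH.
    by case/andP: rb => r0 rb; apply/andP; split => //; lra.
  by rewrite exprS in ra; lra.
move=> r rb; pose k := Num.truncn (r / a); apply: (H k.+1) => //.
case/andP: rb => r0 rb.
rewrite -ler_pdivrMr//; apply: (@le_trans _ _ k.+1%:R); first exact/ltW/truncnS_gt.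
by rewrite -natrX ler_nat ltnW// ltn_expl.
Qed.

(** The lower bound of [energy_thin] is this factor, where [c] is a lower bound
   for the density of the surface, times [eta `^ (p + 8) * rho `^ (8 - p)]. *)
Definition energy_factor p c : R :=
  ((24 * 4 ^+ 4)^-1 `^ p) * (c * 112^-1 ^+ 2) ^+ 4.

Lemma energy_factor_gt0 p c : 0 < c -> 0 < energy_factor p c.
Proof.
move=> c0; have k0 : 0 < (24 * 4 ^+ 4 : R)^-1 by rewrite invr_gt0 mulr_gt0// exprn_gt0.
by rewrite mulr_gt0// ?powR_gt0// exprn_gt0// mulr_gt0// exprn_gt0.
Qed.

Lemma energy_factorP p c eta rho E : 0 < eta -> 0 < rho -> 0 < c ->
  E * rho `^ (p - 8) <= energy_factor p c * (eta `^ p * eta ^+ 8) ->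
  E <= (eta / (24 * 4 ^+ 4) / rho) `^ p * (c * (eta / 112 * rho) ^+ 2) ^+ 4.
Proof.
move=> e0 r0 c0 h.
have k0 : 0 <= (24 * 4 ^+ 4 : R)^-1 by rewrite invr_ge0 mulr_ge0// exprn_ge0.
have r8 : 0 < rho `^ (p - 8) by rewrite powR_gt0.
have rE : rho `^ p = rho `^ (p - 8) * rho ^+ 8.
  by rewrite -powR_mulrn ?(ltW r0)// -powRD ?subrK// (gt_eqF r0) implybT.
rewrite -(ler_pM2r r8) (le_trans h)//.
rewrite !powRM ?mulr_ge0 ?(ltW e0) ?invr_ge0 ?(ltW r0)//.
rewrite (_ : rho^-1 `^ p = (rho `^ p)^-1); last first.
  by rewrite -powR_inv1 ?(ltW r0)// -powRrM mulrC powRrM powR_inv1// powR_ge0.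
rewrite rE /energy_factor; move: (_^-1 `^ p) (eta `^ p) (rho `^ _) r8 => K L M M0.
rewrite le_eqVlt; apply/orP; left; apply/eqP; field.
by rewrite !gt_eqF.
Qed.

Lemma powR_vanish kappa c e : 0 < kappa -> 0 < c -> 0 < e ->
  exists2 b : R, 0 < b & forall rho, 0 < rho <= b -> c * rho `^ kappa <= e.
Proof.
move=> k0 c0 e0; exists ((e / c) `^ kappa^-1); first by rewrite powR_gt0// divr_gt0.
move=> rho /andP[r0 rb]; rewrite mulrC -ler_pdivlMr//.
have -> : e / c = (e / c) `^ kappa^-1 `^ kappa.
  by rewrite -powRrM mulVf ?gt_eqF// powRr1// divr_ge0// ltW.
by apply: (ge0_ler_powR (ltW k0)); rewrite ?nnegrE ?powR_ge0// ltW.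
Qed.

Lemma triad_flat_energy U x n p c eta rho E : open U -> boundary U x ->
  0 < p -> 0 < c -> 0 < eta -> 128 * eta < 1 -> 0 < rho ->
  (forall y, boundary U y -> ((c * (eta / 112 * rho) ^+ 2)%:E <=
     hausdorff2 (boundary U `&` eball y (eta / 112 * rho)))%E) ->
  (menger_energy p (boundary U) < E%:E)%E ->
  E * rho `^ (p - 8) <= energy_factor p c * (eta `^ p * eta ^+ 8) ->
  triad U x (rho / 4) n ->
  exists m, flat U x rho m (16 * eta).
Proof.
move=> oU bx p0 c0 e0 e128 r0 ahl hE hEr tri.
have cb : closed (boundary U).
  by apply: closedI; [exact: closed_closure|exact/open_closedC/open_interior].
have r4 : 4 * (rho / 4) = rho by field.
have rr : 0 < rho / 4 by lra.
have := triad_flat oU bx rr e0 e128 tri; rewrite r4; apply.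
apply: (energy_thin p0 c0 e0 _ r0 cb ahl hE); first by lra.
exact: energy_factorP.
Qed.

(** The surface is [boundary U]; [K] is the constant of its lower density bound
   and [S'] its dense set of points with a double cone. *)
Definition admissible_data U S' (K : R) : Prop :=
  [/\ open U, 0 < K,
      forall x r, boundary U x -> 0 < r -> (r%:E <= ediam (boundary U))%E ->
        ((K^-1 * r ^+ 2)%:E <= hausdorff2 (boundary U `&` eball x r))%E,
      S' `<=` boundary U /\ boundary U `<=` closure S' &
      forall x, S' x -> two_sided_cone_condition U x].

(** A flatness that lets the propagation start over at each scale: [128 * eta0]
   is below the threshold of [triad_flat], and [64 * eta0], the flatness after
   recentring, below that of [flat_triad]. *)
Definition eta0 : R := (8 * 8 * 8)^-1.

Lemma eta0_gt0 : 0 < eta0. Proof. by rewrite /eta0 invr_gt0 !mulr_gt0. Qed.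

(** The cone at [x] gives triads up to a scale that depends on [x], and flatness is
   propagated from there by doubling. The tetrahedra are thin, by the density
   bound of the surface, up to a scale that does not depend on [x]. *)
Lemma flat_small_scales p E U S' K : 8 < p -> 0 < E -> admissible_data U S' K ->
  (menger_energy p (boundary U) < E%:E)%E ->
  exists2 b : R, 0 < b & forall x rho, S' x -> 0 < rho <= b ->
    exists n, flat U x rho n (16 * eta0).
Proof.
move=> p8 E0 [oU K0 ahl [S'b dense] cone] hE.
have [S'0|/set0P[z S'z]] := eqVneq S' set0.
  by exists 1 => // x rho; rewrite S'0.
have tri x : S' x -> exists2 d : R, 0 < d & forall rho, 0 < rho <= d ->
    exists n, triad U x rho n.
  move=> /cone[v [d [v1 d0 Cp Cn]]]; exists (d / 2) => [|rho /andP[r0 rd]]; first by lra.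
  by exists v; apply: (cone_triad oU v1 Cp Cn r0); lra.
have [d1 d10 d1d] : exists2 d : R, 0 < d & (d%:E <= ediam (boundary U))%E.
  have [d d0 /(_ d)] := tri _ S'z; rewrite d0 lexx.
  move=> /(_ isT)[n [e1 [e2 [s [t [[[ee1 _ nn] [_ e1n _] _] _ b1 _ _]]]]]].
  exists (enorm (d *: (e1 + s *: n))).
    rewrite enorm_gt0 scaler_eq0 gt_eqF//=; apply/eqP => q.
    have : dot (e1 + s *: n) e1 = 1 by rewrite dotDl dotZl ee1 (dotC n) e1n; ring.
    by rewrite q dot0l; lra.
  rewrite -[X in enorm X](addrKl z); apply: enorm_le_ediam => //.
  exact: S'b.
have p80 : 0 < p - 8 by lra.
have K1 : 0 < K^-1 by rewrite invr_gt0.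
have p0 : 0 < p by lra.
have e0 := eta0_gt0.
have G0 : 0 < energy_factor p K^-1 * (eta0 `^ p * eta0 ^+ 8).
  by rewrite mulr_gt0 ?energy_factor_gt0// mulr_gt0 ?powR_gt0 ?exprn_gt0.
have [b1 b10 hb1] := powR_vanish p80 E0 G0.
have e1 : 128 * eta0 < 1 by rewrite /eta0; lra.
pose b := Num.min b1 d1.
have b0 : 0 < b by rewrite lt_min b10.
have bb1 : b <= b1 by rewrite ge_min lexx.
have bd1 : b <= d1 by rewrite ge_min lexx orbT.
exists b => // x rho S'x; move: rho.
have grow rho n : 0 < rho <= b -> triad U x (rho / 4) n ->
    exists m, flat U x rho m (16 * eta0).
  move=> /andP[r0 rb]; have rb1 : 0 < rho <= b1 by rewrite r0 (le_trans rb).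
  apply: (triad_flat_energy oU (S'b _ S'x) p0 K1 e0 e1 r0 _ hE (hb1 _ rb1)).
  move=> y by_; apply: ahl => //; first by rewrite !mulr_gt0.
  by apply: le_trans d1d; rewrite lee_fin /eta0; lra.
have [d d0 trid] := tri _ S'x.
apply: (@dyadic_induction _ d).
- by [].
- move=> r /andP[r0 rd] rb; have [|n tn] := trid (r / 4); first by apply/andP; split; lra.
  by apply: (grow _ n) => //; rewrite r0.
- move=> r /[dup] rb /andP[r0 _] IH.
  have [|n fn] := IH (r / 2); first by apply/andP; split; lra.
  apply: (grow _ n) => //; apply: (@flat_triad _ _ _ _ _ (16 * eta0)) => //.
  - by lra.
  - by rewrite /eta0; lra.
  - by rewrite (_ : 2 * (r / 4) = r / 2)//; field.
Qed.

Lemma flat_dense_ahlfors U S' K x rho : admissible_data U S' K -> 0 < rho ->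
  (forall z, S' z -> exists n, flat U z (rho / 2) n (16 * eta0)) ->
  boundary U x ->
  ((128^-1 * rho ^+ 2)%:E <= hausdorff2 (boundary U `&` eball x rho))%E.
Proof.
move=> [oU _ _ [S'b dense] _] r0 fl bx.
have r20 : 0 < rho / 2 by lra.
have [z S'z xz] := (closureE_enorm S' x).1 (dense _ bx) _ r20.
have [n fn] := fl z S'z.
have e2 : 16 * eta0 <= 2^-1 by rewrite /eta0; lra.
apply: le_trans (le_trans (flat_ahlfors oU r20 e2 fn) _).
  by rewrite lee_fin; lra.
apply: le_hausdorff2; apply: setIS; apply: sub_eball; rewrite enormBC; lra.
Qed.

(** Flatness propagates from arbitrarily small scales, where the constants
   depend on the surface, up to a scale that depends on [p] and [E] only: while
   the surface is flat at all smaller scales, its density is at least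
   [128^-1]. *)
Lemma flat_uniform_scales p E : 8 < p -> 0 < E ->
  exists2 b : R, 0 < b & forall U S' K, admissible_data U S' K ->
  (menger_energy p (boundary U) < E%:E)%E ->
  forall x rho, boundary U x -> 0 < rho <= b ->
    (exists n, flat U x rho n (64 * eta0)) /\
    ((128^-1 * rho ^+ 2)%:E <= hausdorff2 (boundary U `&` eball x rho))%E.
Proof.
move=> p8 E0; have p0 : 0 < p by lra.
have p80 : 0 < p - 8 by lra.
have e0 := eta0_gt0.
have i128 : 0 < 128^-1 :> R by rewrite invr_gt0.
have e1 : 128 * eta0 < 1 by rewrite /eta0; lra.
have G0 : 0 < energy_factor p 128^-1 * (eta0 `^ p * eta0 ^+ 8).
  by rewrite mulr_gt0 ?energy_factor_gt0// mulr_gt0 ?powR_gt0 ?exprn_gt0.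
have [b b0 hb] := powR_vanish p80 E0 G0.
exists (b / 2); first by lra.
move=> U S' K adm hE.
have [oU K0 ahl [S'b dense] cone] := adm.
have [a a0 fla] := flat_small_scales p8 E0 adm hE.
have flb : forall rho, 0 < rho <= b -> forall z, S' z -> exists n, flat U z rho n (16 * eta0).
  apply: (@dyadic_induction _ a) => //.
    by move=> r ra _ z S'z; exact: fla.
  move=> r /[dup] rb /andP[r0 _] IH z S'z.
  have [|n fn] := IH (r / 2) _ z S'z; first by apply/andP; split; lra.
  apply: (triad_flat_energy oU (S'b _ S'z) p0 i128 e0 e1 r0 _ hE (hb _ rb)).
    move=> y by_; apply: (flat_dense_ahlfors adm) => //; first by rewrite !mulr_gt0.
    move=> w S'w; apply: IH => //; apply/andP; split; first by rewrite !mulr_gt0.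
    by rewrite /eta0; lra.
  apply: (@flat_triad _ _ _ _ n (16 * eta0)) => //.
  - by lra.
  - by rewrite /eta0; lra.
  - by rewrite (_ : 2 * (r / 4) = r / 2)//; field.
move=> x rho bx /andP[r0 rb]; split; last first.
  apply: (flat_dense_ahlfors adm) => // z S'z; apply: flb => //.
  by apply/andP; split; lra.
have [z S'z xz] := (closureE_enorm S' x).1 (dense _ bx) _ r0.
have [|n fn] := flb (2 * rho) _ z S'z; first by apply/andP; split; lra.
exists n; rewrite (_ : 64 * eta0 = 4 * (16 * eta0)); last by ring.
exact: flat_recentre oU bx fn xz.
Qed.

(** With the uniform density the tetrahedra at scale [rho] are thin for
   [eta = N * tau], where [tau `^ (p + 16) = E * rho `^ (p - 8)]: the condition
   of [triad_flat_energy] has the smaller exponent [p + 8] on [tau], which is at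
   most one. *)
Lemma flat_power_scales p : 8 < p ->
  exists2 M : R, 0 < M & forall E, 0 < E ->
  exists2 b : R, 0 < b &
  (forall rho, 0 < rho <= b ->
     M * (E * rho `^ (p - 8)) `^ (p + 16)^-1 <= 32^-1) /\
  forall U S' K, admissible_data U S' K ->
  (menger_energy p (boundary U) < E%:E)%E ->
  forall x rho, boundary U x -> 0 < rho <= b ->
    exists n, flat U x rho n (M * (E * rho `^ (p - 8)) `^ (p + 16)^-1).
Proof.
move=> p8; have p0 : 0 < p by lra.
have p80 : 0 < p - 8 by lra.
have i128 : 0 < 128^-1 :> R by rewrite invr_gt0.
have F0 := energy_factor_gt0 p i128; set F := energy_factor p 128^-1 in F0.
(* With this choice the factor [F * N `^ (p + 8)] is at least one. *)
pose N := Num.max 1 F^-1.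
have N1 : 1 <= N by rewrite le_max lexx.
have N0 : 0 < N by lra.
have FN : 1 <= F * N.
  by rewrite mulrC -ler_pdivrMr// div1r le_max lexx orbT.
exists (16 * N) => [|E E0]; first by lra.
have q0 : 0 < (p + 16)^-1 by rewrite invr_gt0; lra.
pose t := (8 * 8 * 8 * N)^-1.
have t0 : 0 < t by rewrite invr_gt0; lra.
have t1 : t <= 1 by rewrite invf_le1; lra.
have G0 : 0 < t `^ (p + 16) by rewrite powR_gt0.
have [b1 b10 hb1] := powR_vanish p80 E0 G0.
have [b2 b20 hb2] := flat_uniform_scales p8 E0.
have pp : p + 16 != 0 by rewrite gt_eqF//; lra.
have small rho : 0 < rho <= b1 -> (E * rho `^ (p - 8)) `^ (p + 16)^-1 <= t.
  move=> /hb1 h.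
  have -> : t = (t `^ (p + 16)) `^ (p + 16)^-1 by rewrite -powRrM mulfV// powRr1// ltW.
  apply: (ge0_ler_powR (ltW q0)) => //; rewrite nnegrE ?powR_ge0//.
  by rewrite mulr_ge0 ?powR_ge0// ltW.
have tN : N * t = eta0 by rewrite /t /eta0; field; rewrite gt_eqF.
exists (Num.min b1 b2); first by rewrite lt_min b10.
split=> [rho /andP[r0]|U S' K adm hE x rho bx /andP[r0]]; rewrite le_min => /andP[rb1 rb2].
  have rb : 0 < rho <= b1 by rewrite r0.
  have := ler_wpM2l (ltW N0) (small _ rb); rewrite tN /eta0; lra.
have rb : 0 < rho <= b1 by rewrite r0.
have E8 : 0 < E * rho `^ (p - 8) by rewrite mulr_gt0// powR_gt0.
have st := small _ rb.
set tau := (_ `^ _) in st *.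
have tau0 : 0 < tau by rewrite powR_gt0.
have [oU _ _ _ _] := adm.
pose eta := N * tau.
have eta_gt0 : 0 < eta by rewrite mulr_gt0.
have eta512 : eta <= (8 * 8 * 8)^-1 by rewrite -[leRHS]tN ler_wpM2l// ltW.
have [|[n fn] _] := hb2 U S' K adm hE x (rho / 2) bx; first by apply/andP; split; lra.
rewrite -mulrA -/eta.
apply: (@triad_flat_energy U x n p 128^-1 eta rho E) => //.
- by lra.
- move=> y by_; have [|_] := hb2 U S' K adm hE y (eta / 112 * rho) by_; last exact.
  apply/andP; split; first by rewrite !mulr_gt0.
  by nra.
- rewrite -/F.
  have -> : E * rho `^ (p - 8) = tau `^ p * (tau ^+ 8 * tau ^+ 8).
    rewrite -exprD -[in tau ^+ _]powR_mulrn ?(ltW tau0)// -powRD; last by rewrite (gt_eqF tau0) implybT.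
    by rewrite /tau -powRrM mulVf// powRr1// ltW.
  rewrite /eta powRM ?(ltW tau0) ?(ltW N0)// exprMn.
  have Np : 1 <= N `^ p by rewrite -[leLHS](powRr0 N) ler_powR// ltW.
  have N8 : N <= N ^+ 8 by rewrite -[leLHS]expr1 ler_weXn2l.
  have FNp : 1 <= F * (N `^ p * N ^+ 8).
    apply: le_trans FN _; rewrite ler_pM2l//.
    by rewrite -[leLHS]mul1r ler_pM// ltW.
  have tau8 : tau ^+ 8 <= 1 by rewrite exprn_ile1// ?(ltW tau0)// (le_trans st).
  have tp : 0 <= tau `^ p * tau ^+ 8 by rewrite mulr_ge0 ?powR_ge0 ?exprn_ge0 ?(ltW tau0).
  rewrite mulrA (_ : F * _ = F * (N `^ p * N ^+ 8) * (tau `^ p * tau ^+ 8)); last by ring.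
  apply: (@le_trans _ _ (tau `^ p * tau ^+ 8)); first by rewrite ler_piMr.
  by rewrite ler_peMl.
- apply: (@flat_triad _ _ _ _ n (64 * eta0)) => //.
  + by lra.
  + by rewrite /eta0; lra.
  + by rewrite (_ : 2 * (rho / 4) = rho / 2)//; field.
Qed.

End scales.
(** * The limit of the normals *)

Section normals.
Variables (R : realType) (U : set 'rV[R]_3) (b kappa B : R).
Implicit Types (x y z n m : 'rV[R]_3) (rho sigma : R).

Let eps rho := B * rho `^ kappa.

Hypotheses (oU : open U) (b0 : 0 < b) (k0 : 0 < kappa) (k1 : kappa <= 1)
  (B0 : 0 < B) (eps_small : forall rho, 0 < rho <= b -> eps rho <= 32^-1)
  (flatU : forall x rho, boundary U x -> 0 < rho <= b ->
    exists n, flat U x rho n (eps rho)).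

(** The sum of the geometric series of the errors [12 * eps (rho / 2 ^+ k)],
   relative to [eps rho]. *)
Definition normal_const : R := 12 / (1 - 2^-1 `^ kappa).

Let half_lt1 : 2^-1 `^ kappa < 1 :> R.
Proof.
have : 2^-1 `^ kappa < 1 `^ kappa :> R.
  by apply: (gt0_ltr_powR k0); rewrite ?nnegrE ?invr_ge0// invf_lt1// ltr1n.
by rewrite powR1.
Qed.

Lemma normal_const_ge12 : 12 <= normal_const.
Proof.
have q0 : 0 < 2^-1 `^ kappa :> R by rewrite powR_gt0// invr_gt0.
have q1 := half_lt1.
rewrite /normal_const ler_pdivlMr; nra.
Qed.

Let eps_gt0 rho : 0 < rho -> 0 < eps rho.
Proof. by move=> r0; rewrite mulr_gt0// powR_gt0. Qed.

Let eps_mono rho sigma : 0 < sigma -> sigma <= rho -> eps sigma <= eps rho.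
Proof.
move=> s0 sr; rewrite ler_pM2l//; apply: (ge0_ler_powR (ltW k0)) => //;
  by rewrite nnegrE ltW// (lt_le_trans s0).
Qed.

Let eps_half rho : 0 < rho -> eps (rho / 2) = 2^-1 `^ kappa * eps rho.
Proof. by move=> r0; rewrite /eps powRM ?invr_ge0// ?ltW//; ring. Qed.

Let eps_double rho : 0 < rho -> eps (2 * rho) <= 2 * eps rho.
Proof.
move=> r0; rewrite /eps powRM//; last exact: ltW.
have : 2 `^ kappa <= 2 :> R by rewrite -[leRHS]powRr1// ler_powR// ler1n.
have := eps_gt0 r0; rewrite /eps; nra.
Qed.

Lemma flat_shrink x rho sigma m e : 0 <= e -> sigma <= rho -> rho <= 2 * sigma ->
  flat U x rho m e -> flat U x sigma m (2 * e).
Proof.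
move=> e0 sr rs [m1 fm]; split=> // y xy.
have [|f1 f2] := fm y; first by rewrite /eball/= in xy *; lra.
have es : e * rho <= 2 * e * sigma by nra.
by split=> h; [apply: f1|apply: f2]; lra.
Qed.

Let close_scales x rho sigma n m : 0 < sigma -> sigma <= rho -> rho <= b ->
  rho <= 2 * sigma -> flat U x sigma n (eps sigma) -> flat U x rho m (eps rho) ->
  enorm (n - m) <= 12 * eps rho.
Proof.
move=> s0 sr rb rs fn fm; have r0 : 0 < rho by lra.
have := flat_shrink (ltW (eps_gt0 r0)) sr rs fm.
have er : eps rho <= 32^-1 by apply: eps_small; rewrite r0.
have es := eps_mono s0 sr.
move=> fm'; rewrite enormBC.
have e1 : eps sigma <= 8^-1 by lra.
have e2 : 2 * eps rho <= 8^-1 by lra.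
by apply: le_trans (flat_compare oU s0 e1 e2 fn fm') _; lra.
Qed.

(** The normals at smaller scales stay close: the errors at dyadic scales form a
   geometric series. *)
Lemma normal_cauchy x rho sigma n m : boundary U x ->
  0 < sigma -> sigma <= rho -> rho <= b ->
  flat U x sigma n (eps sigma) -> flat U x rho m (eps rho) ->
  enorm (n - m) <= normal_const * eps rho.
Proof.
move=> bx s0 sr rb fn fm.
pose P r := sigma <= r -> forall m, flat U x r m (eps r) ->
  enorm (n - m) <= normal_const * eps r.
have C12 := normal_const_ge12.
have base r : 0 < r <= 2 * sigma -> r <= b -> P r.
  move=> /andP[r0 rs] rb' sr' m' fm'.
  apply: le_trans (close_scales s0 sr' rb' rs fn fm') _.
  by rewrite ler_wpM2r// ltW// eps_gt0.
suff : P rho by apply.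
have s20 : 0 < 2 * sigma by lra.
apply: (dyadic_induction s20 base); last by rewrite (lt_le_trans s0).
move=> r /andP[r0 rb'] IH sr' m' fm'.
have [r2|r2] := leP r (2 * sigma); first by apply: base => //; rewrite r0.
have r20 : 0 < r / 2 <= b by apply/andP; split; lra.
have [n' fn'] := flatU bx r20.
have h1 : enorm (n - n') <= normal_const * eps (r / 2).
  by apply: IH fn' => //; [apply/andP; split; lra|lra].
have h2 : enorm (n' - m') <= 12 * eps r by apply: close_scales fn' fm' => //; lra.
apply: le_trans (enorm_dist3 n n' m') _.
rewrite (eps_half r0) in h1.
have q1 := half_lt1.
have -> : normal_const * eps r = normal_const * (2^-1 `^ kappa * eps r) + 12 * eps r.
  by rewrite /normal_const; field; rewrite gt_eqF// subr_gt0.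
exact: lerD.
Qed.

(** By [normal_cauchy], the intervals of radius [normal_const * eps rho] about a
   coordinate of the normals at scale [rho] meet pairwise; the supremum of their
   lower ends lies in all of them. *)
Lemma normal_limit x : boundary U x -> exists nx, enorm nx = 1 /\
  forall rho m, 0 < rho <= b -> flat U x rho m (eps rho) ->
    enorm (m - nx) <= 2 * (normal_const * eps rho).
Proof.
move=> bx; have C12 := normal_const_ge12.
pose low (i : 'I_3) := [set r | exists rho m, [/\ 0 < rho <= b,
  flat U x rho m (eps rho) & r = m 0 i - normal_const * eps rho]].
have bb : 0 < b <= b by rewrite b0 lexx.
have [m0 fm0] := flatU bx bb.
have ce rho : 0 < rho -> 0 <= normal_const * eps rho.
  by move=> r0; rewrite mulr_ge0 ?(ltW (eps_gt0 r0))//; lra.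
have ub i rho m : 0 < rho <= b -> flat U x rho m (eps rho) ->
    ubound (low i) (m 0 i + normal_const * eps rho).
  move=> /andP[r0 rb] fm _ [sigma [n [/andP[s0 sb] fn ->]]].
  have [sr|rs] := leP sigma rho.
    have := le_trans (coord_le_enorm _ i) (normal_cauchy bx s0 sr rb fn fm).
    by rewrite !mxE ler_norml => /andP[_]; have := ce _ s0; lra.
  have := le_trans (coord_le_enorm _ i) (normal_cauchy bx r0 (ltW rs) sb fm fn).
  by rewrite !mxE ler_norml => /andP[+ _]; have := ce _ r0; lra.
have hs i : has_sup (low i).
  split; last by exists (m0 0 i + normal_const * eps b); exact: ub.
  by exists (m0 0 i - normal_const * eps b), b, m0.
pose nx : 'rV[R]_3 := \row_i sup (low i).
have close rho m : 0 < rho <= b -> flat U x rho m (eps rho) ->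
    enorm (m - nx) <= 2 * (normal_const * eps rho).
  move=> rb fm; apply: enorm_le_coord => i; rewrite !mxE ler_norml.
  have s1 : sup (low i) <= m 0 i + normal_const * eps rho.
    by apply: ge_sup; [exact: (hs i).1|exact: ub].
  have s2 : m 0 i - normal_const * eps rho <= sup (low i).
    by apply: ub_le_sup; [exact: (hs i).2|exists rho, m].
  by apply/andP; split; lra.
exists nx; split=> //.
have nx1 : `|enorm nx - 1| <= 0.
  apply/ler_addgt0Pr => e e0; rewrite add0r.
  have C0 : 0 <= normal_const by lra.
  have c0 : 0 < 2 * (normal_const * B) by rewrite mulr_gt0// mulr_gt0//; lra.
  have [r0 r00 hr] := powR_vanish k0 c0 e0.
  pose rho := Num.min b r0.
  have rho0 : 0 < rho by rewrite lt_min b0.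
  have rhob : 0 < rho <= b by rewrite rho0 ge_min lexx.
  have [m fm] := flatU bx rhob.
  have := close _ _ rhob fm; have [m1 _] := fm.
  have : 0 < rho <= r0 by rewrite rho0 ge_min lexx orbT.
  move=> /hr; rewrite -!mulrA -/(eps rho) => h1 h2.
  have t1 : enorm nx <= enorm m + enorm (m - nx).
    by rewrite enormBC -{1}(subrK m nx) addrC enormD.
  have t2 : enorm m <= enorm (m - nx) + enorm nx by rewrite -{1}(subrK nx m) enormD.
  by rewrite m1 in t1 t2; rewrite ler_norml; apply/andP; split; lra.
by apply/eqP; rewrite -subr_eq0 -normr_le0.
Qed.

Section limit_normal.
Variables (x nx : 'rV[R]_3).
Hypotheses (bx : boundary U x) (nx1 : enorm nx = 1)
  (nxP : forall rho m, 0 < rho <= b -> flat U x rho m (eps rho) ->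
    enorm (m - nx) <= 2 * (normal_const * eps rho)).

(** The slab at scale [enorm (y - x)] itself, tilted by the distance of its
   normal to the limit. *)
Lemma limit_normal_tangent y : boundary U y -> enorm (y - x) <= b ->
  `|dot (y - x) nx| <= (1 + 2 * normal_const) * B * enorm (y - x) `^ (1 + kappa).
Proof.
move=> by_ yb; have [->|yx] := eqVneq y x.
  have C12 := normal_const_ge12.
  have C0 : 0 <= 1 + 2 * normal_const by lra.
  by rewrite subrr dot0l normr0 mulr_ge0 ?powR_ge0// mulr_ge0// ltW.
have r0 : 0 < enorm (y - x) by rewrite enorm_gt0 subr_eq0.
set rho := enorm (y - x) in yb r0 *.
have rb : 0 < rho <= b by rewrite r0.
have [m fm] := flatU bx rb.
have h1 : `|dot (y - x) m| <= eps rho * rho.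
  by apply: (flat_slab oU fm by_); rewrite /eball/=.
have h2 : `|dot (y - x) (m - nx)| <= rho * (2 * (normal_const * eps rho)).
  by apply: le_trans (dot_le _ _) _; rewrite ler_wpM2l ?enorm_ge0// nxP.
rewrite powRD; last by rewrite (gt_eqF r0) implybT.
rewrite powRr1 ?(ltW r0)//.
rewrite (_ : (1 + 2 * normal_const) * B * (rho * rho `^ kappa) =
  eps rho * rho + rho * (2 * (normal_const * eps rho))); last by rewrite /eps; ring.
rewrite (_ : dot (y - x) nx = dot (y - x) m - dot (y - x) (m - nx)); last first.
  by rewrite dotBr; ring.
by apply: le_trans (ler_normB _ _) _; rewrite lerD.
Qed.

(** A second tangent plane would confine the boundary, near [x], to a line up
   to a height of smaller order, but its projection to the first plane contains
   a disc. *)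
Lemma limit_normal_unique m (D delta : R) : 0 < delta -> enorm m = 1 ->
  (forall y, boundary U y -> enorm (y - x) <= delta ->
    `|dot (y - x) m| <= D * enorm (y - x) `^ (1 + kappa)) ->
  m = dot m nx *: nx.
Proof.
move=> d0 m1 hm; apply/eqP; rewrite -subr_eq0 -enorm_eq0.
rewrite eq_le enorm_ge0 andbT; apply/ler_addgt0Pr => e e0; rewrite add0r.
have C12 := normal_const_ge12.
pose c := 2 * (B + `|D|) + 2 * (2 * (normal_const * B)).
have c0 : 0 < c.
  have C0 : 0 < normal_const by lra.
  have CB : 0 < normal_const * B by rewrite mulr_gt0.
  rewrite /c; move: CB (normr_ge0 D); move: (normal_const * B) `|D| => u v u0 v0.
  by rewrite addr_gt0// mulr_gt0// ?mulr_gt0// ltr_wpDr.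
have [r0 r00 hr] := powR_vanish k0 c0 e0.
have [rho [rho0 rhob rhod rhor]] : exists rho,
    [/\ 0 < rho, rho <= b, rho <= delta & rho <= r0].
  exists (Num.min (Num.min b delta) r0).
  by rewrite !lt_min b0 d0 r00 !ge_min !lexx !orbT.
have [n fn] : exists n, flat U x rho n (eps rho) by apply: flatU => //; rewrite rho0.
have [n1 _] := fn.
have er : eps rho <= 2^-1.
  by have := eps_small (rho := rho); rewrite rho0 rhob => /(_ isT); lra.
have slab y : boundary U y -> eball x rho y ->
    `|dot (y - x) m| <= (`|D| * rho `^ kappa) * rho.
  rewrite /eball/= => by_ yr; apply: le_trans (hm _ by_ (le_trans yr rhod)) _.
  have -> : `|D| * rho `^ kappa * rho = `|D| * rho `^ (1 + kappa).
    by rewrite powRD ?(gt_eqF rho0) ?implybT// powRr1 ?(ltW rho0)//; ring.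
  have k10 : 0 <= 1 + kappa by rewrite addr_ge0// ltW.
  apply: (@le_trans _ _ (`|D| * enorm (y - x) `^ (1 + kappa))).
    by rewrite ler_wpM2r ?powR_ge0// ler_norm.
  rewrite ler_wpM2l//; apply: (ge0_ler_powR k10) => //; rewrite nnegrE ?enorm_ge0//.
  exact: ltW.
have tilt := flat_tilt oU rho0 er fn m1 slab.
have rhob' : 0 < rho <= b by rewrite rho0.
have nnx := nxP rhob' fn.
have rr : 0 < rho <= r0 by rewrite rho0.
have -> : m - dot m nx *: nx = (m - dot m n *: n) +
    (dot m (n - nx) *: n + dot m nx *: (n - nx)).
  by rewrite dotBr; apply/rowP => i; rewrite !mxE; ring.
apply: le_trans (enormD _ _) (le_trans (lerD tilt (enormD _ _)) _).
rewrite !enormZ n1 mulr1.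
have l1 : `|dot m (n - nx)| <= enorm (n - nx).
  by apply: le_trans (dot_le _ _) _; rewrite m1 mul1r.
have l2 : `|dot m nx| <= 1 by apply: le_trans (dot_le _ _) _; rewrite m1 nx1 mul1r.
have l3 : `|dot m nx| * enorm (n - nx) <= enorm (n - nx).
  by rewrite ler_piMl// enorm_ge0.
apply: le_trans (hr _ rr).
rewrite (_ : c * rho `^ kappa = 2 * (eps rho + `|D| * rho `^ kappa) +
  (2 * (normal_const * eps rho) + 2 * (normal_const * eps rho))); last by rewrite /c /eps; ring.
by lra.
Qed.

End limit_normal.
(** The normals at [x] and [y] are compared at the scale of their distance. *)
Lemma limit_normal_holder x y nx ny : boundary U x -> boundary U y ->
  (forall rho m, 0 < rho <= b -> flat U x rho m (eps rho) ->
    enorm (m - nx) <= 2 * (normal_const * eps rho)) ->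
  (forall rho m, 0 < rho <= b -> flat U y rho m (eps rho) ->
    enorm (m - ny) <= 2 * (normal_const * eps rho)) ->
  0 < enorm (x - y) -> 2 * enorm (x - y) <= b ->
  enorm (nx - ny) <= (6 * normal_const + 36) * eps (enorm (x - y)).
Proof.
move=> bx by_ nxP nyP; set d := enorm _ => d0 db.
have C12 := normal_const_ge12.
have db1 : 0 < d <= b by rewrite d0; lra.
have db2 : 0 < 2 * d <= b by rewrite mulr_gt0.
have [n fn] := flatU bx db1; have [m fm] := flatU by_ db2.
have hn := nxP _ _ db1 fn; have hm := nyP _ _ db2 fm.
have fm' := flat_recentre oU bx fm (lexx d).
have e1 : eps d <= 8^-1 by have := eps_small db1; lra.
have e2 : 4 * eps (2 * d) <= 8^-1 by have := eps_small db2; lra.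
have nm := flat_compare oU d0 e1 e2 fn fm'.
have ed := eps_double d0.
rewrite (_ : nx - ny = - (n - nx) + (- (m - n) + (m - ny))); last first.
  by apply/rowP => i; rewrite !mxE; ring.
apply: le_trans (enormD _ _) (le_trans (lerD (lexx _) (enormD _ _)) _).
rewrite !enormN.
have C0 : 0 <= normal_const by lra.
have ced := ler_wpM2l C0 ed.
by lra.
Qed.

End normals.
(** * Planes and their angles *)

Section planes.
Variable R : realType.
Implicit Types (n m v w x y z : 'rV[R]_3) (P Q : {vspace 'rV[R]_3}).

Lemma plane_exists n : enorm n = 1 ->
  exists P, \dim P = 2%N /\ forall v, (v \in P) = (dot n v == 0).
Proof.
move=> n1; have [e1 [e2 [[ee1 ee2 nn] [e12 e1n e2n] d1]]] := frame_exists n1.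
have ne1 : dot n e1 = 0 by rewrite dotC.
have ne2 : dot n e2 = 0 by rewrite dotC.
have e21 : dot e2 e1 = 0 by rewrite dotC.
have e10 : e1 != 0 by apply/eqP => q; move: ee1; rewrite q dot0l; lra.
have e20 : e2 != 0 by apply/eqP => q; move: ee2; rewrite q dot0l; lra.
exists (<[e1]> + <[e2]>)%VS; split.
  rewrite dimv_disjoint_sum ?dim_vline ?e10 ?e20//.
  apply/eqP; rewrite -subv0; apply/subvP => v; rewrite memv_cap => /andP[].
  move=> /vlineP[a ->] /vlineP[c q].
  have : dot (a *: e1) e1 = 0 by rewrite q dotZl e21 mulr0.
  by rewrite dotZl ee1 mulr1 => ->; rewrite scale0r mem0v.
move=> v; apply/idP/eqP.
  move=> /memv_addP[_ /vlineP[a ->] [_ /vlineP[c ->] ->]].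
  by rewrite !dot_linear ne1 ne2; ring.
move=> nv; apply/memv_addP; exists (dot v e1 *: e1); first by rewrite memvZ// memv_line.
exists (dot v e2 *: e2); first by rewrite memvZ// memv_line.
apply/eqP; rewrite -subr_eq0 -enorm_eq0; apply/eqP.
set w := v - _.
have w1 : dot w e1 = 0 by rewrite /w !dot_linear ee1 e21; ring.
have w2 : dot w e2 = 0 by rewrite /w !dot_linear ee2 e12; ring.
have wn : dot w n = 0 by rewrite /w !dot_linear e1n e2n (dotC v) nv; ring.
by rewrite -[w]scale1r -d1 det3_dual_basis w1 w2 wn !scale0r !addr0 enorm0.
Qed.

Lemma dim2_eq P Q : \dim P = 2%N -> \dim Q = 2%N -> (P <= Q)%VS -> P = Q.
Proof. by move=> dP dQ PQ; apply/eqP; rewrite eqEdim PQ dP dQ. Qed.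

(** The cross product of two basis vectors vanishes, by the Lagrange identity,
   only if they are parallel. *)
Lemma normal_exists P : \dim P = 2%N ->
  exists n, enorm n = 1 /\ forall v, v \in P -> dot n v = 0.
Proof.
move=> dP; have fr := basis_free (vbasisP P); have sp := span_basis (vbasisP P).
have := size_tuple (vbasis P); move=> /esym/(etrans (esym dP))/esym.
move: (vbasis P : seq _) fr sp => [|a [|c [|//]]]//= + sp _.
rewrite free_cons seq1_free span_seq1 => /andP[ac c0].
pose n := cross a c.
have n0 : n != 0.
  apply: contra ac => /eqP q; have := lagrange_identity a c; rewrite -/n q dot0l => lag.
  have cc : dot c c != 0 by rewrite enormK sqrf_eq0 enorm_eq0.
  apply/vlineP; exists (dot a c / dot c c); apply/eqP.
  rewrite -subr_eq0 -enorm_eq0 -sqrf_eq0 -enormK !dot_linear (dotC c a).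
  apply/eqP; transitivity ((dot a a * dot c c - dot a c ^+ 2) / dot c c).
    by field.
  by rewrite -lag mul0r.
exists ((enorm n)^-1 *: n); split.
  by rewrite enormZ ger0_norm ?invr_ge0 ?enorm_ge0// mulVf// enorm_eq0.
move=> v; rewrite -sp span_cons span_seq1.
move=> /memv_addP[_ /vlineP[k ->] [_ /vlineP[l ->] ->]].
rewrite dotZl (_ : dot n _ = 0) ?mulr0// !dot_linear -!/(det3 _ _ _) !det3E; ring.
Qed.

Lemma mem_planeP P n : \dim P = 2%N -> enorm n = 1 ->
  (forall v, v \in P -> dot n v = 0) -> forall v, (v \in P) = (dot n v == 0).
Proof.
move=> dP n1 nP; have [Q [dQ QE]] := plane_exists n1.
rewrite (dim2_eq dP dQ _)//; apply/subvP => v /nP nv.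
by rewrite QE nv.
Qed.

Lemma unit_normalP P : \dim P = 2%N -> enorm (unit_normal P) = 1 /\
  forall v, (v \in P) = (dot (unit_normal P) v == 0).
Proof.
move=> dP; have [n [n1 nP]] := normal_exists dP.
have [m1 mP] : enorm (unit_normal P) = 1 /\
    forall v, v \in P -> dot (unit_normal P) v = 0.
  exact: (@xgetPex _ 0 [set n | enorm n = 1 /\ forall v, v \in P -> dot n v = 0]
    (ex_intro _ n (conj n1 nP))).
by split=> //; exact: mem_planeP.
Qed.

Lemma normal_unique P n m : enorm n = 1 ->
  (forall v, (v \in P) = (dot n v == 0)) -> (forall v, (v \in P) = (dot m v == 0)) ->
  m = dot m n *: n.
Proof.
move=> n1 nP mP; have nn : dot n n = 1 by rewrite enormK n1 expr1n.
have [w wE] : exists w, w = m - dot m n *: n by eexists.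
have nw : dot n w = 0 by rewrite wE !dot_linear nn (dotC n m); ring.
have mw : dot m w = 0 by apply/eqP; rewrite -mP nP nw.
apply/eqP; rewrite -subr_eq0 -wE -enorm_eq0 -sqrf_eq0 -enormK.
by rewrite {1}wE dotBl dotZl mw nw mulr0 subr0.
Qed.

Lemma dist_to_plane P n x z : enorm n = 1 ->
  (forall v, (v \in P) = (dot n v == 0)) ->
  dist_to z (translate x [set v | v \in P]) = `|dot (z - x) n|.
Proof.
move=> n1 nP; have nn : dot n n = 1 by rewrite enormK n1 expr1n.
apply/eqP; rewrite eq_le; apply/andP; split.
  pose v := z - x - dot (z - x) n *: n.
  have vP : v \in P by rewrite nP /v dotBr dotZr nn (dotC n); apply/eqP; ring.
  have : translate x [set v | v \in P] (x + v) by exists v.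
  move=> /(dist_to_le z); rewrite (_ : z - (x + v) = dot (z - x) n *: n).
    by rewrite enormZ n1 mulr1.
  by rewrite /v; apply/rowP => i; rewrite !mxE; ring.
apply: lb_le_inf.
  by exists (enorm (z - (x + 0))), (x + 0) => //; exists 0 => //=; rewrite mem0v.
move=> _ [_ [v /= + <-] <-]; rewrite nP dotC => /eqP vn.
rewrite (_ : dot (z - x) n = dot (z - (x + v)) n).
  by apply: le_trans (dot_le _ _) _; rewrite n1 mulr1.
by rewrite opprD addrA [in RHS]dotBl vn subr0.
Qed.

(** With [t = acos s], the claim is [t <= 4 * sin t] on the first quadrant; it
   follows from [sin t = 2 * cos (t / 2) * sin (t / 2)], as the cosine is at
   least one half up to [pi / 4]. *)
Lemma acos_le (s : R) : 0 <= s <= 1 -> acos s <= 4 * Num.sqrt (1 - s ^+ 2).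
Proof.
move=> /andP[s0 s1].
have sI : -1 <= s <= 1 by apply/andP; split; lra.
have sII : s \in `[-1, 1] by rewrite in_itv.
have t0 := acos_ge0 sI; have tp := acos_lepi sI.
rewrite -sin_acos//; have := acosK sII; move: (acos s) t0 tp => t t0 tp ct.
have c4 : 2^-1 <= cos (pi / 4 : R).
  have p4 : 0 <= cos (pi / 4 : R).
    apply: cos_ge0_pihalf; have := pi_gt0 R; move: (pi : R) => q q0.
    by apply/andP; split; lra.
  have := cos_mulr2n (pi / 4 : R); rewrite (_ : pi / 4 *+ 2 = pi / 2); last first.
    by rewrite -mulr_natr; move: (pi : R) => q; field.
  by rewrite cos_pihalf -mulr_natr; nra.
have t2 : t <= pi / 2.
  rewrite leNgt; apply/negP => tgt.
  have : cos t < cos (pi / 2).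
    have := pi_gt0 R => q0.
    by rewrite ltr_cos// in_itv/=; apply/andP; split=> //; move: q0; move: (pi : R) => q; lra.
  by rewrite cos_pihalf ct; lra.
have cle (u : R) : 0 <= u <= pi / 4 -> 2^-1 <= cos u.
  move=> /andP[u0 u4]; apply: le_trans c4 _.
  have := pi_gt0 R => q0.
  rewrite leNgt ltr_cos -?leNgt//; rewrite in_itv/=; apply/andP; split=> //;
    move: q0 u4; move: (pi : R) => q; lra.
have [->|tn0] := eqVneq t 0; first by rewrite sin0 mulr0.
have t4 : t / 2 <= pi / 4 by move: t2; move: (pi : R) => q; lra.
have tpos : 0 < t / 2 by rewrite divr_gt0// lt_neqAle eq_sym tn0.
have csin : {within `[0, t / 2], continuous (@sin R)}.
  by apply: continuous_subspaceT => r; exact: continuous_sin.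
have [c] := @MVT R sin cos 0 (t / 2) tpos (fun (r : R) _ => is_derive_sin r) csin.
rewrite in_itv/= => /andP[c0 ch]; rewrite sin0 !subr0 => sE.
have cc : 2^-1 <= cos c by apply: cle; apply/andP; split; lra.
have ct2 : 2^-1 <= cos (t / 2) by apply: cle; apply/andP; split; lra.
have -> : sin t = 2 * (cos (t / 2) * sin (t / 2)).
  by rewrite [in LHS](splitr t) -mulr2n sin_mulr2n -mulr_natr mulrC.
rewrite sE; have ab : 4^-1 <= cos (t / 2) * cos c by nra.
have := ler_wpM2r t0 ab; lra.
Qed.

End planes.

Section angles.
Variable R : realType.
Implicit Types (x y n m : 'rV[R]_3) (P Q : {vspace 'rV[R]_3}).

(** The sine of the angle is the distance from [n] to the line of [m]. *)
Lemma plane_angle_le P Q n m : \dim P = 2%N -> \dim Q = 2%N ->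
  enorm n = 1 -> enorm m = 1 ->
  (forall v, (v \in P) = (dot n v == 0)) -> (forall v, (v \in Q) = (dot m v == 0)) ->
  plane_angle P Q <= 4 * enorm (n - m).
Proof.
move=> dP dQ n1 m1 nP mQ.
have [un uP] := unit_normalP dP; have [um uQ] := unit_normalP dQ.
have := normal_unique n1 nP uP; have := normal_unique m1 mQ uQ.
set k := dot _ m => qE; set l := dot _ n => pE.
have unit1 (c : R) (u v : 'rV[R]_3) : enorm u = 1 -> enorm v = 1 -> u = c *: v -> `|c| = 1.
  by move=> u1 v1 uv; rewrite -u1 uv enormZ v1 mulr1.
rewrite /plane_angle pE qE dotZl dotZr !normrM (unit1 _ _ _ un n1 pE) (unit1 _ _ _ um m1 qE) !mul1r.
have d1 : `|dot n m| <= 1 by rewrite (le_trans (dot_le _ _))// n1 m1 mulr1.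
apply: le_trans (acos_le _) _; first by rewrite normr_ge0.
rewrite ler_pM2l// real_normK ?num_real//.
rewrite -(ger0_norm (enorm_ge0 _)) -sqrtr_sqr; apply: ler_wsqrtr.
rewrite -enormK !dot_linear !enormK n1 m1 (dotC m n).
by move: d1; rewrite ler_norml => /andP[d1 d2]; nra.
Qed.

Lemma scale_exponent (p E M rho : R) : 0 <= E -> 0 < rho ->
  M * (E * rho `^ (p - 8)) `^ (p + 16)^-1 =
  (M * E `^ (p + 16)^-1) * rho `^ ((p - 8) / (p + 16)).
Proof. by move=> E0 r0; rewrite powRM ?powR_ge0// -powRrM mulrA. Qed.

End angles.

(** * Tangent planes *)

Theorem theorem5p4 (R : realType) (p : R) (hp : 8 < p) :
  let kappa := (p - 8) / (p + 16) in
  exists A : R, forall E : R, 0 < E ->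
  exists delta1 C : R, 0 < delta1 /\
  forall Sigma : set 'rV[R]_3,
    admissible Sigma -> (menger_energy p Sigma < E%:E)%E ->
    (forall x, Sigma x ->
       exists! P : {vspace 'rV[R]_3},
         is_tangent_plane kappa delta1 C Sigma x P) /\
    (forall (x y : 'rV[R]_3) (TxSigma TySigma : {vspace 'rV[R]_3}),
       Sigma x -> Sigma y ->
       is_tangent_plane kappa delta1 C Sigma x TxSigma ->
       is_tangent_plane kappa delta1 C Sigma y TySigma ->
       0 < enorm (x - y) -> enorm (x - y) <= delta1 ->
       plane_angle TxSigma TySigma <=
         A * E `^ (1 / (p + 16)) * enorm (x - y) `^ kappa).
Proof.
move=> kappa.
have k0 : 0 < kappa by rewrite divr_gt0//; lra.
have k1 : kappa <= 1 by rewrite ler_pdivrMr; lra.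
have [M M0 HM] := flat_power_scales hp.
pose N : R := normal_const kappa.
exists (4 * (6 * N + 36) * M) => E E0.
have [b b0 [hb hflat]] := HM E E0.
pose B := M * E `^ (p + 16)^-1.
have B0 : 0 < B by rewrite mulr_gt0// powR_gt0.
exists (b / 2), ((1 + 2 * N) * B); split; first by lra.
move=> Sigma [_ _ [U [[oU _ _ _] SE [K K0 ahl] [S' [S'S dense] cone]]]] hE.
subst Sigma.
have adm : admissible_data U S' K.
  by split=> // x r bx r0 rd; have /andP[] := ahl x r bx r0 rd.
have eps_small rho : 0 < rho <= b -> B * rho `^ kappa <= 32^-1.
  move=> /[dup] rb /andP[r0 _]; rewrite -(scale_exponent _ _ (ltW E0) r0).
  exact: hb _ rb.
have flatU x rho : boundary U x -> 0 < rho <= b ->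
    exists n, flat U x rho n (B * rho `^ kappa).
  move=> bx /[dup] rb /andP[r0 _]; rewrite -(scale_exponent _ _ (ltW E0) r0).
  exact: hflat adm hE _ _ bx rb.
have lim x (bx : boundary U x) := normal_limit oU b0 k0 B0 eps_small flatU bx.
(* The tangent planes at [x], in the sense of the theorem, are exactly the
   orthogonal complements of the limit normal. *)
have tangent x P nx : boundary U x -> enorm nx = 1 ->
    (forall rho m, 0 < rho <= b -> flat U x rho m (B * rho `^ kappa) ->
      enorm (m - nx) <= 2 * (N * (B * rho `^ kappa))) ->
    is_tangent_plane kappa (b / 2) ((1 + 2 * N) * B) (boundary U) x P <->
    \dim P = 2%N /\ forall v, (v \in P) = (dot nx v == 0).
  move=> bx nx1 nxP; split=> [[dP hP]|[dP nP]]; split=> //.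
    have [m1 mP] := unit_normalP dP.
    have mE : unit_normal P = dot (unit_normal P) nx *: nx.
      have b2 : 0 < b / 2 by lra.
      apply: (limit_normal_unique oU b0 k0 B0 eps_small flatU bx nx1 nxP b2 m1).
      move=> y by_ yb; rewrite -(dist_to_plane x y m1 mP); exact: hP.
    have d0 : dot (unit_normal P) nx != 0.
      by apply/eqP => d0; move: m1; rewrite mE d0 scale0r enorm0 => /eqP; rewrite eq_sym oner_eq0.
    by move=> v; rewrite mP mE dotZl mulf_eq0 (negbTE d0).
  move=> y [by_ yb]; rewrite (dist_to_plane x y nx1 nP).
  apply: (limit_normal_tangent oU k0 B0 flatU bx nxP by_).
  by rewrite /eball/= in yb; lra.
split=> [x bx|x y P Q bx by_ tP tQ d0 db].
  have [nx [nx1 nxP]] := lim x bx.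
  have [P [dP nP]] := plane_exists nx1.
  exists P; split; first by apply/(tangent x P nx bx nx1 nxP).
  move=> Q /(tangent x Q nx bx nx1 nxP)[_ nQ].
  by apply/vspaceP => v; rewrite nP nQ.
have [nx [nx1 nxP]] := lim x bx; have [ny [ny1 nyP]] := lim y by_.
have [dP nP] := (tangent x P nx bx nx1 nxP).1 tP.
have [dQ nQ] := (tangent y Q ny by_ ny1 nyP).1 tQ.
apply: le_trans (plane_angle_le dP dQ nx1 ny1 nP nQ) _.
have d2 : 2 * enorm (x - y) <= b by lra.
have := limit_normal_holder oU k0 k1 B0 eps_small flatU bx by_ nxP nyP d0 d2.
rewrite div1r -/N; move: (enorm (nx - ny)) => u hu.
rewrite (_ : _ * _ * _ = 4 * ((6 * N + 36) * (B * enorm (x - y) `^ kappa))).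
  by rewrite ler_pM2l.
by rewrite /B; ring.
Qed.
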